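(* Let $0<r<2$ and let $\rho$ be a quantum state with density matrix $[\rho_{m,n}]_{m,n\in\mathbb N}$. Assume that there exists $B>0$ such that, for all $m\ge n$, $$|\rho_{m,n}|\le e^{-B(m+n)^{r/2}}.$$ Then for all $\beta<B$ there exists $z_0$, depending only on $r,B,\beta$, such that $z:=\sqrt{q^2+p^2}\ge z_0$ implies $$|W_\rho(q,p)|\le A(z)\,e^{-\beta z^r}\qquad\text{and}\qquad |\widetilde W_\rho(q,p)|\le A(z/2)\,e^{-\beta(z/2)^r},$$ where $$A(z)=\frac1\pi\left(\sum_{m,n\in\mathbb N}e^{-B(m+n)^{r/2}}+\frac{4}{Br}z^{4-r}\right).$$
   Context: Notation: $\mathbb N=\{0,1,2,\dots\}$. Fock basis of $L^2(\mathbb R)$: $h_m(x)=(2^m m!\sqrt\pi)^{-1/2}H_m(x)e^{-x^2/2}$, $H_m(x)=(-1)^m e^{x^2}\frac{d^m}{dx^m}e^{-x^2}$. A quantum state is a selfadjoint, positive, trace-one operator $\rho$ on $L^2(\mathbb R)$, with density matrix $\rho_{m,n}=\langle h_m,\rho h_n\rangle$. Its Wigner function is $W_\rho(q,p)=\sum_{m,n}\rho_{m,n}W_{m,n}(q,p)$ with $W_{m,n}(q,p)=\frac1\pi\int e^{2ipx}h_m(q-x)h_n(q+x)\,dx$, and its Fourier transform is $\widetilde W_\rho(u,v)=\iint e^{-i(uq+vp)}W_\rho(q,p)\,dq\,dp$. *)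

(* Defs.v *)
From HB Require Import structures.
From mathcomp Require Import all_boot all_order all_algebra.
From mathcomp Require Import complex.
From mathcomp Require Import all_classical all_reals all_analysis.

Set Implicit Arguments.
Unset Strict Implicit.
Unset Printing Implicit Defensive.

Import Order.TTheory GRing.Theory Num.Theory.
Import numFieldNormedType.Exports.

Local Open Scope classical_set_scope.
Local Open Scope ring_scope.
Local Open Scope complex_scope.

Section ComplexIntegralsAndSums.
Variable R : realType.

Definition cintegral d (T : measurableType d) (mu : {measure set T -> \bar R})
    (f : T -> R[i]) : R[i] :=
  (\int[mu]_x complex.Re (f x))%R +i* (\int[mu]_x complex.Im (f x))%R.

(* Unordered summation.  The value is the usual one when the family is
   absolutely summable, and is meaningless otherwise. *)
Definition rsum (I : choiceType) (a : I -> R) : R :=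
  fine (\esum_(i in [set: I]) (a^\+ i)%:E - \esum_(i in [set: I]) (a^\- i)%:E)%E.

Definition csum (I : choiceType) (a : I -> R[i]) : R[i] :=
  rsum (fun i => complex.Re (a i)) +i* rsum (fun i => complex.Im (a i)).

Definition expi (t : R) : R[i] := cos t +i* sin t.

End ComplexIntegralsAndSums.

Section L2.
Variable R : realType.
Local Notation mu := (@lebesgue_measure R).

(* Elements of L^2(R; C) are handled through representatives, equality in L^2
   being equality almost everywhere. *)
Definition L2 (f : R -> R[i]) : Prop :=
  [/\ measurable_fun setT (fun x => complex.Re (f x)),
      measurable_fun setT (fun x => complex.Im (f x)) &
      (\int[mu]_x (Normc.normc (f x) ^+ 2)%:E < +oo)%E].

(* Antilinear in the first argument. *)
Definition inner (f g : R -> R[i]) : R[i] :=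
  cintegral mu (fun x => (f x)^* * g x).

Definition hermite (m : nat) (x : R) : R :=
  (-1) ^+ m * expR (x ^+ 2) * derive1n m (fun y : R => expR (- y ^+ 2)) x.

Definition fock (m : nat) (x : R) : R :=
  (Num.sqrt (2 ^+ m * m`!%:R * Num.sqrt pi))^-1 * hermite m x
  * expR (- x ^+ 2 / 2).

Definition cfock (m : nat) (x : R) : R[i] := (fock m x)%:C.

Definition density_matrix (rho : (R -> R[i]) -> (R -> R[i])) (m n : nat)
    : R[i] :=
  inner (cfock m) (rho (cfock n)).

(* An everywhere defined selfadjoint operator is bounded (Hellinger-Toeplitz),
   so boundedness is not a separate clause.  Positivity is stated in the order
   of R[i], for which 0 <= w means that w is real and nonnegative.  For a
   positive operator the trace does not depend on the orthonormal basis; it is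
   computed in the Fock basis, where its terms are real and nonnegative. *)
Record quantum_state (rho : (R -> R[i]) -> (R -> R[i])) : Prop := {
  qs_L2 : forall f, L2 f -> L2 (rho f) ;
  qs_ae : forall f g, L2 f -> L2 g -> f = g %[ae mu] ->
    rho f = rho g %[ae mu] ;
  qs_linear : forall (a : R[i]) f g, L2 f -> L2 g ->
    rho (fun x => a * f x + g x) = (fun x => a * rho f x + rho g x) %[ae mu] ;
  qs_selfadjoint : forall f g, L2 f -> L2 g ->
    inner f (rho g) = inner (rho f) g ;
  qs_positive : forall f, L2 f -> 0 <= inner f (rho f) ;
  qs_trace : (\sum_(0 <= n <oo) (complex.Re (density_matrix rho n n))%:E
              = 1)%E
}.

End L2.

Section Wigner.
Variable R : realType.
Local Notation mu := (@lebesgue_measure R).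

Definition wigner_coef (m n : nat) (q p : R) : R[i] :=
  (pi^-1)%:C * cintegral mu (fun x =>
    expi (2 * p * x) * (fock m (q - x))%:C * (fock n (q + x))%:C).

Definition wigner (rho : (R -> R[i]) -> (R -> R[i])) (q p : R) : R[i] :=
  csum (fun k : nat * nat =>
    density_matrix rho k.1 k.2 * wigner_coef k.1 k.2 q p).

Definition fourier2 (W : R -> R -> R[i]) (u v : R) : R[i] :=
  cintegral (mu \x mu)%E (fun z : R * R =>
    expi (- (u * z.1 + v * z.2)) * W z.1 z.2).

Definition wigner_fourier (rho : (R -> R[i]) -> (R -> R[i])) : R -> R -> R[i] :=
  fourier2 (wigner rho).

Definition decay (B r : R) (m n : nat) : R :=
  expR (- B * ((m + n)%:R `^ (r / 2))).

Definition decay_amplitude (r B z : R) : R :=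
  pi^-1 * (rsum (fun k : nat * nat => decay B r k.1 k.2)
           + 4 / (B * r) * z `^ (4 - r)).

End Wigner.

(* Main.v *)
Require Import Defs.
From mathcomp Require Import all_boot all_order all_algebra.
From mathcomp Require Import complex.
From mathcomp Require Import all_classical all_reals all_analysis.
From mathcomp Require Import measurable_realfun.
From mathcomp Require Import ring lra.

Set Implicit Arguments.
Unset Strict Implicit.
Unset Printing Implicit Defensive.

Import Order.TTheory GRing.Theory Num.Theory.
Import numFieldNormedType.Exports.

Local Open Scope classical_set_scope.
Local Open Scope ring_scope.
Local Open Scope complex_scope.

(** Put [k(x) = h_m(q - x) h_n(q + x)].  Up to the factor [1/pi], [W_mn(q,p)] is
    the Fourier integral [cross m n q p = \int exp(2ipx) k(x) dx], so everything
    rests on good control of [cross].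

    Rotation.  The ladder relations of the Fock functions and one integration by
    parts give recurrences that express [cross m.+1 n] and [cross m n.+1] as
    [q -+ ip] times [cross m n] plus a lower term ([cross_raise_l],
    [cross_raise_r]).  They start from [cross 0 0 q p = exp(- q^2 - p^2)], so a
    rotation of [(q,p)] only multiplies [cross m n] by a phase, and
    [|cross m n q p| = |cross m n z 0|] ([norm_cross]).

    Decay.  At [(z,0)] no oscillation is left, and it suffices to know how
    fast Fock functions decay.  Since [h_n'' = (x^2 - 2n - 1) h_n], integrating
    the derivative of [h_n h_n' exp(a x^2)] bounds [\int h_n^2 exp(a x^2)] by
    [(2n + 2) exp(a(2n + 2)/(1 - a^2))] ([fock_weighted]).  Hence, for every [a] in
    [[0,1[], [|cross m n q p|] is at most a polynomial in [m, n] times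
    [exp(a (m+n+2)/(1 - a^2) - a z^2)] ([cross_bound]).  For small
    [a] the exponent is close to [a (m+n+2 - z^2)], hence negative as soon as [m + n]
    is smaller than [z^2] by a fixed proportion; a worse threshold than [z^2] would
    not reach every [beta < B].

    Summation.  In [\sum |rho_mn| |W_mn|] the terms with [m+n <= (1-t) z^2] are
    [O(exp(- a^2 z^2))] for a small fixed [a], which is negligible because
    [r < 2].  The others are bounded by [exp(- B (m+n)^(r/2))] alone, so
    they lose only a factor arbitrarily close to [1] in the rate
    ([weighted_sum_decay]).  All constants are absorbed in the gap between [beta]
    and [B], and it is enough to compare with the first term of the sum in
    [A(z)], which is [1].

    Fourier transform.  Fourier inversion in [p] turns [cross m n q] into
    [pi k(v/2)] ([cross_inversion]); integrating the result against
    [exp(- iuq)] gives back, because [h_m] has the parity of [m],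
    [(-1)^m pi cross m n (v/2) (- u/2)] ([fourier2_cross]).  The transform of
    [W_rho] is thus a series of the same kind at distance [z/2], once sum and
    integral have been exchanged.  The exchange is legitimate since
    [a = 1/(m+n+2)] in [cross_bound] shows that the [L^1] norm of
    [W_mn] grows only polynomially. *)

(** * Functions of Gaussian decay *)

Section gaussian_class.
Variable R : realType.
Local Notation mu := (@lebesgue_measure R).
Implicit Types (f g : R -> R) (c : R).

(* [expR (- c x^2)] is a multiple of the normal density of variance [1/(2c)]. *)
Let gauss_normal_pdf c : 0 < c -> exists2 s,
  normal_peak s = (Num.sqrt (pi / c))^-1 &
  (fun x => expR (- c * x ^+ 2)) =
  (fun x => (normal_peak s)^-1 * normal_pdf 0 s x).
Proof.
move=> c0; exists (Num.sqrt (c *+ 2)^-1).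
  rewrite /normal_peak sqr_sqrtr ?invr_ge0 ?mulrn_wge0 ?ltW//; congr (Num.sqrt _)^-1.
  by rewrite -[in LHS]mulr_natr -[in LHS](mulr_natr c); field; lra.
have c20 : 0 < (c *+ 2)^-1 by rewrite invr_gt0 mulrn_wgt0.
have s0 : Num.sqrt (c *+ 2)^-1 != 0 by rewrite gt_eqF// sqrtr_gt0.
apply/funext => x; rewrite normal_pdfE// mulKf ?gt_eqF ?normal_peak_gt0//.
rewrite /normal_fun subr0 sqr_sqrtr ?ltW// -[in RHS]mulr_natr -[in RHS](mulr_natr c).
by congr expR; field; lra.
Qed.

Lemma integrable_gauss c : 0 < c ->
  mu.-integrable setT (EFin \o (fun x => expR (- c * x ^+ 2))).
Proof.
move=> c0; have [s _ ->] := gauss_normal_pdf c0.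
exact: (integrableZl measurableT _ (integrable_normal_pdf 0 s)).
Qed.

Lemma integral_gauss c : 0 < c ->
  \int[mu]_x expR (- c * x ^+ 2) = Num.sqrt (pi / c).
Proof.
move=> c0; have [s ps ->] := gauss_normal_pdf c0.
rewrite RintegralZl//; last exact: integrable_normal_pdf.
by rewrite /Rintegral integral_normal_pdf mulr1 ps invrK.
Qed.

(** The rate [c] may be negative, so that [x] itself and the weights [expR (a x^2)]
    fall under the single product rule [gauss_rateM]. *)
Definition gauss_rate c f :=
  continuous f /\ exists C, forall x, `|f x| <= C * expR (- c * x ^+ 2).

Let gauss_rate_bound_ge0 c C f :
  (forall x, `|f x| <= C * expR (- c * x ^+ 2)) -> 0 <= C.
Proof.
move=> fC; rewrite -(pmulr_lge0 _ (expR_gt0 (- c * 0 ^+ 2))).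
exact: le_trans (fC 0).
Qed.

Lemma gauss_rateM c d f g : gauss_rate c f -> gauss_rate d g ->
  gauss_rate (c + d) (fun x => f x * g x).
Proof.
move=> [cf [C fC]] [cg [D gD]]; split.
  by move=> x; apply: cvgM; [exact: cf|exact: cg].
exists (C * D) => x; rewrite normrM opprD mulrDl expRD mulrACA.
by apply: ler_pM.
Qed.

Lemma gauss_rateD c f g : gauss_rate c f -> gauss_rate c g ->
  gauss_rate c (fun x => f x + g x).
Proof.
move=> [cf [C fC]] [cg [D gD]]; split.
  by move=> x; apply: cvgD; [exact: cf|exact: cg].
by exists (C + D) => x; rewrite mulrDl (le_trans (ler_normD _ _))// lerD.
Qed.

Lemma gauss_rate_le c d f : d <= c -> gauss_rate c f -> gauss_rate d f.
Proof.
move=> dc [cf [C fC]]; split=> //; exists C => x; rewrite (le_trans (fC x))//.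
have C0 : 0 <= C by exact: gauss_rate_bound_ge0 fC.
by rewrite ler_wpM2l// ler_expR ler_wpM2r ?sqr_ge0// lerN2.
Qed.

Lemma gauss_rate_bounded f M : continuous f -> (forall x, `|f x| <= M) ->
  gauss_rate 0 f.
Proof.
by move=> cf fM; split=> //; exists M => x; rewrite oppr0 mul0r expR0 mulr1.
Qed.

Lemma gauss_rate_cst (r : R) : gauss_rate 0 (cst r).
Proof. by apply: (@gauss_rate_bounded _ `|r|) => // x; exact: cvg_cst. Qed.

Lemma gauss_rateZ c (r : R) f : gauss_rate c f -> gauss_rate c (fun x => r * f x).
Proof. by move=> /(gauss_rateM (gauss_rate_cst r)); rewrite add0r. Qed.

Lemma gauss_rateB c f g : gauss_rate c f -> gauss_rate c g ->
  gauss_rate c (fun x => f x - g x).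
Proof.
move=> cf /(gauss_rateZ (-1)) cg.
by under eq_fun do rewrite -mulN1r; exact: gauss_rateD.
Qed.

Lemma gauss_rate_id c : c < 0 -> gauss_rate c id.
Proof.
move=> c0; split; first by move=> x; exact: cvg_id.
exists (1 + (- c)^-1) => x.
have e := expR_ge1Dx (- c * x ^+ 2).
have Nc0 : 0 < - c by rewrite oppr_gt0.
have h : 0 < (- c)^-1 by rewrite invr_gt0.
apply: (@le_trans _ _ ((1 + (- c)^-1) * (1 + - c * x ^+ 2))); last first.
  by rewrite ler_wpM2l// addr_ge0// ltW.
rewrite mulrDl mul1r mulrDr mulr1 mulKf ?gt_eqF//.
rewrite -(real_normK (num_real x)); have x0 := normr_ge0 x.
have : 0 <= - c * `|x| ^+ 2 by rewrite mulr_ge0 ?sqr_ge0// ltW.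
by set y := _ * _; move=> y0; nra.
Qed.

Lemma gauss_rateX c d f : d < c -> gauss_rate c f ->
  gauss_rate d (fun x => x * f x).
Proof.
move=> dc; rewrite -subr_lt0 in dc => /(gauss_rateM (gauss_rate_id dc)).
by rewrite subrK.
Qed.

Lemma gauss_rate_gauss c : gauss_rate c (fun x => expR (- c * x ^+ 2)).
Proof.
split; last by exists 1 => x; rewrite mul1r ger0_norm ?expR_ge0.
move=> x; apply: (@continuous_comp _ _ _ (fun x : R => - c * x ^+ 2) expR).
  by apply: cvgM; [exact: cvg_cst|exact: exprn_continuous].
exact: continuous_expR.
Qed.

Lemma gauss_rate_cos (w : R) : gauss_rate 0 (fun x => cos (w * x)).
Proof.
apply: (@gauss_rate_bounded _ 1) => x; last first.
  by rewrite ler_norml cos_geN1 cos_le1.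
apply: (@continuous_comp _ _ _ (fun x : R => w * x) cos).
  by apply: cvgM; [exact: cvg_cst|exact: cvg_id].
exact: continuous_cos.
Qed.

Lemma gauss_rate_sin (w : R) : gauss_rate 0 (fun x => sin (w * x)).
Proof.
apply: (@gauss_rate_bounded _ 1) => x; last first.
  by rewrite ler_norml sin_geN1 sin_le1.
apply: (@continuous_comp _ _ _ (fun x : R => w * x) sin).
  by apply: cvgM; [exact: cvg_cst|exact: cvg_id].
exact: continuous_sin.
Qed.

(** The rate is halved because [(q + x)^2 >= x^2/2 - q^2]. *)
Lemma gauss_rate_shift c f (q : R) : 0 <= c -> gauss_rate c f ->
  gauss_rate (c / 2) (fun x => f (q + x)).
Proof.
move=> c0 [cf [C fC]]; split.
  move=> x; apply: (@continuous_comp _ _ _ (fun x : R => q + x) f); last exact: cf.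
  by apply: cvgD; [exact: cvg_cst|exact: cvg_id].
have C0 : 0 <= C by exact: gauss_rate_bound_ge0 fC.
exists (C * expR (c * q ^+ 2)) => x; apply: (le_trans (fC (q + x))).
rewrite -mulrA ler_wpM2l// -expRD ler_expR.
rewrite -subr_ge0.
have -> : c * q ^+ 2 + - (c / 2) * x ^+ 2 - - c * (q + x) ^+ 2 =
    c / 2 * (x + 2 * q) ^+ 2 by field.
by rewrite mulr_ge0 ?sqr_ge0// divr_ge0.
Qed.

Lemma gauss_rate_opp c f : gauss_rate c f -> gauss_rate c (fun x => f (- x)).
Proof.
move=> [cf [C fC]]; split.
  move=> x; apply: (@continuous_comp _ _ _ (fun x : R => - x) f); last exact: cf.
  by apply: cvgN; exact: cvg_id.
by exists C => x; rewrite (le_trans (fC (- x)))// sqrrN.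
Qed.

Lemma gauss_rate_reflect c f (q : R) : 0 <= c -> gauss_rate c f ->
  gauss_rate (c / 2) (fun x => f (q - x)).
Proof. by move=> c0 cf; exact: (gauss_rate_opp (gauss_rate_shift q c0 cf)). Qed.

Lemma gauss_rate_measurable c f : gauss_rate c f -> measurable_fun setT f.
Proof. by move=> [cf _]; exact: continuous_measurable_fun. Qed.

Lemma gauss_rate_integrable c f : 0 < c -> gauss_rate c f ->
  mu.-integrable setT (EFin \o f).
Proof.
move=> c0 cf; have [_ [C fC]] := cf.
apply: (@le_integrable _ _ _ mu _ measurableT _
  (fun x => C%:E * (expR (- c * x ^+ 2))%:E)%E).
- by apply/measurable_EFinP; exact: gauss_rate_measurable cf.
- move=> x _; rewrite /= lee_fin (le_trans (fC x))//.
  exact: ler_norm.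
- by apply: integrableZl => //; exact: integrable_gauss.
Qed.

Lemma gauss_rate_cvg0 c f (u : R^nat) : 0 < c -> gauss_rate c f ->
  (forall n, n%:R <= `|u n|) -> f (u n) @[n --> \oo] --> 0.
Proof.
move=> c0 [_ [C fC]] un.
have C0 : 0 <= C by exact: gauss_rate_bound_ge0 fC.
have h : (C * (2 + c^-1)) * (n.+1%:R^-1 : R) @[n --> \oo] --> (0:R).
  rewrite -(mulr0 (C * (2 + c^-1))); apply: cvgM; first exact: cvg_cst.
  exact: cvg_harmonic.
apply/norm_cvg0P; apply: (@squeeze_cvgr _ _ _ _ (cst 0) _ _ _ _ _ h); last exact: cvg_cst.
apply: nearW => n; rewrite normr_ge0/=; apply: (le_trans (fC (u n))).
rewrite -mulrA ler_wpM2l//.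
rewrite mulNr expRN ler_pdivlMr// mulrC ler_pdivrMr ?expR_gt0//.
apply: (@le_trans _ _ ((2 + c^-1) * (1 + c * u n ^+ 2))); last first.
  by rewrite ler_wpM2l ?expR_ge1Dx// addr_ge0// invr_ge0 ltW.
rewrite -(real_normK (num_real (u n))).
rewrite mulrDl (mulrDr c^-1) mulr1 mulKf ?gt_eqF//.
have h1 := un n; have h2 : 0 <= c * `|u n| ^+ 2 by rewrite mulr_ge0 ?sqr_ge0// ltW.
have h3 : 0 <= c^-1 by rewrite invr_ge0 ltW.
rewrite -natr1; have : 0 <= (n%:R : R) by [].
by move: h1 h2 h3; set v := `|u n|; set y := c * _; set d := c^-1; nra.
Qed.

(** By the fundamental theorem on [[-n, n]], the integral is the limit of
    [F n - F (- n)].  This is the only form of integration by parts used below. *)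
Lemma Rintegral_derivative c F f : 0 < c -> gauss_rate c F -> gauss_rate c f ->
  (forall x : R, is_derive x 1 F (f x)) -> \int[mu]_x f x = 0.
Proof.
move=> c0 cF cf dF; have intf := gauss_rate_integrable c0 cf.
pose g n := f \_ (`[- n%:R, n%:R] : set R).
have gint n : (\int[mu]_x (g n.+1 x)%:E = (F n.+1%:R - F (- n.+1%:R))%:E)%E.
  rewrite EFinB -(@continuous_FTC2 _ f F)//.
  - by rewrite [RHS]integral_mkcond; apply: eq_integral => x _; rewrite restrict_EFin.
  - by rewrite ltrNl (lt_trans (_ : - _ < 0)) ?oppr_lt0.
  - by apply: continuous_subspaceT; case: cf.
  - split.
    + by move=> x _; apply: ex_derive.
    + by apply: cvg_at_right_filter; case: cF => + _; apply.
    + by apply: cvg_at_left_filter; case: cF => + _; apply.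
  - by move=> x _; rewrite derive1E; apply: derive_val.
have mg n : measurable_fun setT (fun x => (g n.+1 x)%:E).
  apply/measurable_EFinP; rewrite /g; apply/(measurable_restrictT _ _).1 => //.
  by apply: measurable_funTS; exact: gauss_rate_measurable cf.
have gf : {ae mu, forall x, setT x -> (g n.+1 x)%:E @[n --> \oo] --> (f x)%:E}.
  apply: aeW => x _; apply: (@cvg_near_cst _ _ _ _ _ _); near=> n.
  rewrite /g patchE mem_set//= in_itv/= -ler_norml -natr1 (@le_trans _ _ n%:R)//.
  - by near: n; exact: nbhs_infty_ger.
  - by rewrite lerDl.
have gle : {ae mu, forall x n, setT x -> (`|(g n.+1 x)%:E| <= `|(f x)%:E|)%E}.
  by apply: aeW => x n _; rewrite lee_fin /g patchE; case: ifP => // _; rewrite normr0.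
have mf : measurable_fun setT (EFin \o f) by exact: measurable_int intf.
have [_ _ H] := @dominated_convergence _ _ _ mu _ measurableT
  (fun n x => (g n.+1 x)%:E) (EFin \o f) _ mg mf gf (integrable_abse intf) gle.
have E : (F n.+1%:R - F (- n.+1%:R))%:E @[n --> \oo] --> (0%:E).
  apply: cvg_EFin; first exact: nearW.
  rewrite -(subr0 0); apply: cvgB.
    by apply: (gauss_rate_cvg0 c0 cF) => n; rewrite ger0_norm// ler_nat.
  by apply: (gauss_rate_cvg0 c0 cF) => n; rewrite normrN ger0_norm// ler_nat.
rewrite /Rintegral -(cvg_lim _ H)//; under eq_fun do rewrite gint.
by rewrite (cvg_lim _ E).
Unshelve. all: by end_near.
Qed.

End gaussian_class.

(** * Fourier integrals of functions of Gaussian decay *)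

Section fourier_transform.
Variable R : realType.
Local Notation mu := (@lebesgue_measure R).
Implicit Types (f g k : R -> R) (c w : R).

Lemma Rintegral_shift f (q : R) : continuous f -> (forall x, 0 <= f x) ->
  \int[mu]_x f (x + q) = \int[mu]_x f x.
Proof.
move=> cf f0; rewrite /Rintegral; congr fine; apply/esym.
have dF : derive1 (fun x : R => x + q) = cst 1.
  by apply/funext => x; rewrite derive1E deriveD// derive_id derive_cst addr0.
rewrite (@increasing_ge0_integration_by_substitutionT _ (fun x => x + q))//.
- by apply: eq_integral => x _; rewrite dF !fctE /= mulr1.
- by move=> x y xy; rewrite ltrD2r.
- by rewrite dF => x; exact: cvg_cst.
- by rewrite dF; exact: is_cvg_cst.
- by rewrite dF; exact: is_cvg_cst.
- exact: cvg_addrr_Ny.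
- exact: cvg_addrr.
Qed.

Definition cosint k w := \int[mu]_x (cos (w * x) * k x).
Definition sinint k w := \int[mu]_x (sin (w * x) * k x).

Lemma sinint0 k : sinint k 0 = 0.
Proof.
rewrite /sinint (@eq_Rintegral _ _ _ mu _ (cst 0)); last first.
  by move=> x _; rewrite mul0r sin0 mul0r.
by rewrite Rintegral_cst// mul0r.
Qed.

Section trig.
Variables (c : R) (k : R -> R).
Hypotheses (c0 : 0 < c) (ck : gauss_rate c k).

Lemma integrable_cos w :
  mu.-integrable setT (EFin \o (fun x => cos (w * x) * k x)).
Proof.
apply: (gauss_rate_integrable c0); rewrite -(add0r c).
exact: (gauss_rateM (gauss_rate_cos w)).
Qed.

Lemma integrable_sin w :
  mu.-integrable setT (EFin \o (fun x => sin (w * x) * k x)).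
Proof.
apply: (gauss_rate_integrable c0); rewrite -(add0r c).
exact: (gauss_rateM (gauss_rate_sin w)).
Qed.

Let ckX : gauss_rate (c / 2) (fun x => x * k x).
Proof. by apply: gauss_rateX ck; have := c0; lra. Qed.

Let intG : mu.-integrable setT (EFin \o (fun x => `|x * k x|)).
Proof.
apply: (@integrable_norm _ _ _ mu _ (fun x => x * k x)).
by apply: (gauss_rate_integrable _ ckX); rewrite divr_gt0.
Qed.

Let dcos (x w : R) :
  is_derive w 1 (fun w => cos (w * x) * k x) (- (sin (w * x) * (x * k x))).
Proof. by apply: is_derive_eq; rewrite /GRing.scale /=; ring. Qed.

Let dsin (x w : R) :
  is_derive w 1 (fun w => sin (w * x) * k x) (cos (w * x) * (x * k x)).
Proof. by apply: is_derive_eq; rewrite /GRing.scale /=; ring. Qed.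

(** Differentiation under the integral, dominated by [|x k x|]. *)
Lemma is_derive_cosint w :
  is_derive w 1 (cosint k) (- sinint (fun x => x * k x) w).
Proof.
have wI : w \in `]w - 1, w + 1[ by rewrite in_itv/=; apply/andP; split; lra.
pose f (w x : R) := cos (w * x) * k x.
have i x : w - 1 < x < w + 1 -> mu.-integrable setT (EFin \o f x).
  by move=> _; exact: integrable_cos.
have d x y : (w - 1 < x < w + 1) -> setT y -> derivable (f ^~ y) x 1.
  by move=> _ _; apply: ex_derive.
have fE x y : partial1of2 f x y = - (sin (x * y) * (y * k y)).
  by rewrite partial1of2E (@derive_val _ _ _ _ _ _ _ (dcos y x)).
have b x y : (w - 1 < x < w + 1) -> setT y -> `|partial1of2 f x y| <= `|y * k y|.
  by move=> _ _; rewrite fE normrN normrM ler_piMl// ler_norml sin_geN1 sin_le1.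
apply: DeriveDef.
  exact: (@derivable_under_integral R _ _ mu f setT measurableT w (w - 1) (w + 1)
  _ i d _ (fun y => normr_ge0 _) intG b).
rewrite -derive1E (@differentiation_under_integral R _ _ mu f setT measurableT
  w (w - 1) (w + 1) _ i d _ (fun y => normr_ge0 _) intG b)//.
rewrite -mulN1r -RintegralZl//; last first.
  apply: (@gauss_rate_integrable _ (c / 2)); first by rewrite divr_gt0.
  by rewrite -(add0r (c / 2)); exact: (gauss_rateM (gauss_rate_sin w)).
by apply: eq_Rintegral => y _; rewrite fE mulN1r.
Qed.

Lemma is_derive_sinint w :
  is_derive w 1 (sinint k) (cosint (fun x => x * k x) w).
Proof.
have wI : w \in `]w - 1, w + 1[ by rewrite in_itv/=; apply/andP; split; lra.
pose f (w x : R) := sin (w * x) * k x.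
have i x : w - 1 < x < w + 1 -> mu.-integrable setT (EFin \o f x).
  by move=> _; exact: integrable_sin.
have d x y : (w - 1 < x < w + 1) -> setT y -> derivable (f ^~ y) x 1.
  by move=> _ _; apply: ex_derive.
have fE x y : partial1of2 f x y = cos (x * y) * (y * k y).
  by rewrite partial1of2E (@derive_val _ _ _ _ _ _ _ (dsin y x)).
have b x y : (w - 1 < x < w + 1) -> setT y -> `|partial1of2 f x y| <= `|y * k y|.
  by move=> _ _; rewrite fE normrM ler_piMl// ler_norml cos_geN1 cos_le1.
apply: DeriveDef.
  exact: (@derivable_under_integral R _ _ mu f setT measurableT w (w - 1) (w + 1)
  _ i d _ (fun y => normr_ge0 _) intG b).
rewrite -derive1E (@differentiation_under_integral R _ _ mu f setT measurableT
  w (w - 1) (w + 1) _ i d _ (fun y => normr_ge0 _) intG b)//.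
by apply: eq_Rintegral => y _; rewrite fE.
Qed.

Variable k' : R -> R.
Hypotheses (ck' : gauss_rate c k') (dk : forall x : R, is_derive x 1 k (k' x)).

Lemma cosint_derivative w : cosint k' w = w * sinint k w.
Proof.
apply/eqP; rewrite -subr_eq0 -RintegralZl//; last exact: integrable_sin.
rewrite -RintegralB//; last 2 first.
- apply: (gauss_rate_integrable c0); rewrite -(add0r c).
  exact: (gauss_rateM (gauss_rate_cos w)).
- apply: (gauss_rate_integrable c0); rewrite -(add0r c); apply: gauss_rateZ.
  exact: (gauss_rateM (gauss_rate_sin w)).
apply/eqP.
apply: (@Rintegral_derivative _ c (fun x => cos (w * x) * k x)) => //.
- by rewrite -(add0r c); exact: (gauss_rateM (gauss_rate_cos w)).
- apply: gauss_rateB; rewrite -(add0r c).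
    exact: (gauss_rateM (gauss_rate_cos w)).
  by apply: gauss_rateZ; exact: (gauss_rateM (gauss_rate_sin w)).
- by move=> x; apply: is_derive_eq; rewrite /GRing.scale /=; ring.
Qed.

Lemma sinint_derivative w : sinint k' w = - w * cosint k w.
Proof.
apply/eqP; rewrite -subr_eq0 -RintegralZl//; last exact: integrable_cos.
rewrite -RintegralB//; last 2 first.
- apply: (gauss_rate_integrable c0); rewrite -(add0r c).
  exact: (gauss_rateM (gauss_rate_sin w)).
- apply: (gauss_rate_integrable c0); rewrite -(add0r c); apply: gauss_rateZ.
  exact: (gauss_rateM (gauss_rate_cos w)).
apply/eqP.
apply: (@Rintegral_derivative _ c (fun x => sin (w * x) * k x)) => //.
- by rewrite -(add0r c); exact: (gauss_rateM (gauss_rate_sin w)).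
- apply: gauss_rateB; rewrite -(add0r c).
    exact: (gauss_rateM (gauss_rate_sin w)).
  by apply: gauss_rateZ; exact: (gauss_rateM (gauss_rate_cos w)).
- by move=> x; apply: is_derive_eq; rewrite /GRing.scale /=; ring.
Qed.

End trig.

(** [phi w * expR (w^2/4)] has derivative zero. *)
Lemma gaussian_ode (phi : R -> R) :
  (forall w, is_derive w 1 phi (- (w / 2) * phi w)) ->
  forall w, phi w = phi 0 * expR (- (w ^+ 2 / 4)).
Proof.
move=> dphi w.
have d0 (x : R) : is_derive x 1 (fun w => phi w * expR (w ^+ 2 / 4)) 0.
  by apply: is_derive_eq; rewrite /GRing.scale /=; field.
have := is_derive_0_is_cst w 0 d0.
by rewrite expr0n/= mul0r expR0 mulr1 => <-; rewrite -mulrA -expRD subrr expR0 mulr1.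
Qed.

Let g0 (x : R) := expR (- 1 * x ^+ 2).

Let cg0 : gauss_rate 1 g0. Proof. exact: gauss_rate_gauss. Qed.

Let dg0 (x : R) : is_derive x 1 g0 (- 2 * (x * g0 x)).
Proof. by rewrite /g0; apply: is_derive_eq; rewrite /GRing.scale /=; ring. Qed.

Let cg0' : gauss_rate (1/2) (fun x => -2 * (x * g0 x)).
Proof. by apply: gauss_rateZ; apply: gauss_rateX cg0; lra. Qed.

Let half0 : (0 < 1/2 :> R). Proof. by []. Qed.

Let cg0h : gauss_rate (1/2) g0.
Proof. by apply: (gauss_rate_le _ cg0); lra. Qed.

(** Both Fourier integrals of the Gaussian [g0] solve [phi' w = - (w/2) phi w]:
    differentiating in [w] brings out a factor [x], and [x g0 = - g0'/2] can be
    integrated by parts. *)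
Lemma cosint_gauss w : cosint g0 w = Num.sqrt pi * expR (- (w ^+ 2 / 4)).
Proof.
have d (v : R) : is_derive v 1 (cosint g0) (- (v / 2) * cosint g0 v).
  have := is_derive_cosint ltr01 cg0 v => h; apply: is_derive_eq.
  have := sinint_derivative half0 cg0h cg0' dg0 v.
  have -> : sinint (fun x => -2 * (x * g0 x)) v = - 2 * sinint (fun x => x * g0 x) v.
    rewrite -RintegralZl//; first by apply: eq_Rintegral => x _; ring.
    apply: (integrable_sin half0); apply: gauss_rateX cg0; lra.
  by move=> E; lra.
rewrite (gaussian_ode d); congr (_ * _); rewrite -[in RHS](divr1 pi) -integral_gauss//.
by apply: eq_Rintegral => x _; rewrite mul0r cos0 mul1r.
Qed.

Lemma sinint_gauss w : sinint g0 w = 0.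
Proof.
have d (v : R) : is_derive v 1 (sinint g0) (- (v / 2) * sinint g0 v).
  have := is_derive_sinint ltr01 cg0 v => h; apply: is_derive_eq.
  have := cosint_derivative half0 cg0h cg0' dg0 v.
  have -> : cosint (fun x => -2 * (x * g0 x)) v = - 2 * cosint (fun x => x * g0 x) v.
    rewrite -RintegralZl//; first by apply: eq_Rintegral => x _; ring.
    apply: (integrable_cos half0); apply: gauss_rateX cg0; lra.
  by move=> E; lra.
by rewrite (gaussian_ode d) sinint0 mul0r.
Qed.

End fourier_transform.

(** * The Fock functions *)

Section fock_functions.
Variable R : realType.
Local Notation mu := (@lebesgue_measure R).
Local Notation sqrt := Num.sqrt.
Local Notation fock := (@fock R).
Local Notation hermite := (@hermite R).

Section gauss_derivatives.
Variable G : nat -> R -> R.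
Hypothesis dG : forall n (x : R), derivable (G n) x 1 -> 'D_1 (G n) x = G n.+1 x.
Hypothesis dG0 : forall x : R, is_derive x 1 (G 0) (- 2 * x * G 0 x).

Let idG n (x l : R) : is_derive x 1 (G n) l -> G n.+1 x = l.
Proof. by move=> d; rewrite -dG; [exact: derive_val|exact: ex_derive]. Qed.

(** The recurrence of the Hermite polynomials, for [G m] the [m]-th derivative of
    [expR (- x^2)].  Differentiability of [G m.+2] follows from the recurrence,
    which is why the three facts are proved together. *)
Lemma gauss_derivatives m :
  [/\ forall x : R, is_derive x 1 (G m) (G m.+1 x),
      forall x : R, is_derive x 1 (G m.+1) (G m.+2 x) &
      forall x, G m.+2 x = - 2 * x * G m.+1 x - 2 * m.+1%:R * G m x].
Proof.
elim: m => [|m [IH1 IH2 IH3]].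
  have G1 : G 1 = fun x => - 2 * x * G 0 x.
    by apply/funext => x; exact: idG.
  have d0 (x : R) : is_derive x 1 (G 0) (G 1 x) by rewrite G1.
  have d1 (x : R) : is_derive x 1 (G 1) (- 2 * x * G 1 x - 2 * 1%:R * G 0 x).
    rewrite G1; apply: is_derive_eq; rewrite G1 /GRing.scale /=; ring.
  split => [//|x|x]; last exact: idG.
  by rewrite (idG (d1 x)).
have e (x : R) : is_derive x 1 (G m.+2) (- 2 * x * G m.+2 x - 2 * m.+2%:R * G m.+1 x).
  have -> : G m.+2 = (fun x => - 2 * x * G m.+1 x - 2 * m.+1%:R * G m x).
    by apply/funext => y; exact: IH3.
  have := IH1 x; have := IH2 x => ? ?.
  apply: is_derive_eq; rewrite /GRing.scale /= IH3 -(natr1 m.+1).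
  by ring.
split => [//|x|x]; last exact: idG.
by rewrite (idG (e x)).
Qed.

End gauss_derivatives.

Let G (m : nat) : R -> R := derive1n m (fun y : R => expR (- y ^+ 2)).

Let dG0 (x : R) : is_derive x 1 (G 0) (- 2 * x * G 0 x).
Proof. by rewrite /G /=; apply: is_derive_eq; rewrite /GRing.scale /=; ring. Qed.

Let dG n (x : R) : derivable (G n) x 1 -> 'D_1 (G n) x = G n.+1 x.
Proof. by move=> _; rewrite /G [in RHS]derive1nS derive1E. Qed.

Let derive1n_gauss := gauss_derivatives dG dG0.

Let G1 (x : R) : G 1 x = - 2 * x * G 0 x.
Proof. by rewrite -dG; [exact: derive_val|exact: ex_derive]. Qed.

Let hermiteG m x : hermite m x = (-1) ^+ m * expR (x ^+ 2) * G m x.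
Proof. by []. Qed.

Lemma hermite0 x : hermite 0 x = 1.
Proof. by rewrite hermiteG /G /= expr0 mul1r -expRD subrr expR0. Qed.

Lemma hermite1 x : hermite 1 x = 2 * x.
Proof.
rewrite hermiteG G1 expr1 (_ : G 0 x = expR (- x ^+ 2))//.
transitivity (2 * x * (expR (x ^+ 2) * expR (- x ^+ 2))); first by ring.
by rewrite -expRD subrr expR0 mulr1.
Qed.

Lemma hermiteSS m x :
  hermite m.+2 x = 2 * x * hermite m.+1 x - 2 * m.+1%:R * hermite m x.
Proof. by rewrite !hermiteG; have [_ _ ->] := derive1n_gauss m; rewrite !exprS; ring. Qed.

Lemma is_derive_hermite m (x : R) :
  is_derive x 1 (hermite m) (2 * x * hermite m x - hermite m.+1 x).
Proof.
have [d _ _] := derive1n_gauss m.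
rewrite (hermiteG m.+1); move: (G m.+1 x) (d x) => g dg.
have -> : hermite m = (fun x => (-1) ^+ m * expR (x ^+ 2) * G m x) by [].
move: (G m) dg => Gm dg; move: ((-1) ^+ m) (exprS (-1 : R) m) => s ->.
by apply: is_derive_eq; rewrite /GRing.scale /=; ring.
Qed.

Let nf m : R := (sqrt (2 ^+ m * m`!%:R * sqrt pi))^-1.

Let nfS m : nf m = sqrt 2 * sqrt m.+1%:R * nf m.+1.
Proof.
rewrite /nf factS natrM exprS.
rewrite (_ : 2 * 2 ^+ m * _ * _ = 2 * m.+1%:R * (2 ^+ m * m`!%:R * sqrt pi)); last by ring.
by rewrite (@sqrtrM _ (2 * m.+1%:R)) ?mulr_ge0// (@sqrtrM _ 2)// invfM mulVKf//.
Qed.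

(** For [m = 0] the coefficient [sqrt 0] kills the term [fock 0.-1]. *)
Lemma fockS m x : sqrt m.+1%:R * fock m.+1 x =
  sqrt 2 * x * fock m x - sqrt m%:R * fock m.-1 x.
Proof.
have s2 : sqrt 2 != 0 :> R by rewrite gt_eqF// sqrtr_gt0.
have s22 : sqrt 2 * sqrt 2 = 2 :> R by rewrite -expr2 sqr_sqrtr.
rewrite /Defs.fock -!/(nf _); case: m => [|m] /=.
  rewrite hermite1 hermite0 sqrtr0 mul0r subr0 (nfS 0) mulr1.
  move: (expR _) (nf 1) => e nf1.
  rewrite -[in LHS]s22; ring.
have sm : sqrt m.+1%:R * sqrt m.+1%:R = m.+1%:R :> R by rewrite -expr2 sqr_sqrtr.
rewrite hermiteSS (nfS m) (nfS m.+1).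
move: (expR _) (nf m.+2) => e nf2; rewrite -[in LHS]sm -[in LHS]s22; ring.
Qed.

Lemma is_derive_fock m (x : R) :
  is_derive x 1 (fock m) (x * fock m x - sqrt 2 * sqrt m.+1%:R * fock m.+1 x).
Proof.
have := is_derive_hermite m x => d.
have -> : fock m = (fun x => nf m * hermite m x * expR (- x ^+ 2 / 2)) by [].
by apply: is_derive_eq; rewrite /GRing.scale /= /Defs.fock -!/(nf _) (nfS m); field.
Qed.

Lemma is_derive_fock_lower m (x : R) :
  is_derive x 1 (fock m) (sqrt 2 * sqrt m%:R * fock m.-1 x - x * fock m x).
Proof.
have := is_derive_fock m x => d; apply: is_derive_eq.
rewrite -mulrA fockS mulrBr !mulrA -expr2 sqr_sqrtr//; ring.
Qed.

(** Every [c < 1/2] is allowed, but in general not [c = 1/2]: the polynomial factor costs an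
    arbitrarily small part of the rate. *)
Lemma fock_gauss_rate m c : c < 1 / 2 -> gauss_rate c (fock m).
Proof.
have r0 d : d < 1 / 2 -> gauss_rate d (fock 0).
  move=> d2; apply: (@gauss_rate_le _ (1 / 2)); first exact: ltW.
  rewrite (_ : fock 0 = (fun x => nf 0 * expR (- (1 / 2) * x ^+ 2))).
    exact/gauss_rateZ/gauss_rate_gauss.
  apply/funext => x; rewrite /Defs.fock hermite0 mulr1 -/(nf 0); congr (_ * expR _).
  by field.
have rS n d : d < 1 / 2 -> (forall e, e < 1 / 2 -> gauss_rate e (fock n)) ->
    gauss_rate d (fock n.-1) -> gauss_rate d (fock n.+1).
  move=> d2 h1 h2.
  have -> : fock n.+1 = (fun x =>
      (sqrt n.+1%:R)^-1 * (sqrt 2 * (x * fock n x) - sqrt n%:R * fock n.-1 x)).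
    apply/funext => x; rewrite mulrA -fockS mulKf// gt_eqF// sqrtr_gt0//.
  apply: gauss_rateZ; apply: gauss_rateB; last exact: gauss_rateZ.
  apply: gauss_rateZ; apply: (@gauss_rateX _ ((d + 1 / 2) / 2)); first lra.
  apply: h1; lra.
suff H n : (forall d, d < 1 / 2 -> gauss_rate d (fock n)) /\
    (forall d, d < 1 / 2 -> gauss_rate d (fock n.+1)) by apply: (H m).1.
elim: n => [|n [IH1 IH2]]; split => // d d2; apply: rS => //.
  exact: r0.
exact: IH1.
Qed.

Lemma fock_opp m x : fock m (- x) = (-1) ^+ m * fock m x.
Proof.
suff H n : fock n (- x) = (-1) ^+ n * fock n x /\
    fock n.+1 (- x) = (-1) ^+ n.+1 * fock n.+1 x by apply: (H m).1.
have sn k : sqrt k.+1%:R != 0 :> R by rewrite gt_eqF// sqrtr_gt0.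
elim: n => [|n [IH1 IH2]]; split => //.
- by rewrite expr0 [RHS]mul1r /Defs.fock !hermite0 sqrrN.
- apply: (mulfI (sn 0%N)); rewrite (fockS 0 (- x)) sqrtr0 mul0r subr0 [RHS]mulrCA (fockS 0 x).
  by rewrite sqrtr0 mul0r subr0 /Defs.fock !hermite0 sqrrN expr1; ring.
- apply: (mulfI (sn n.+1)); rewrite fockS/= IH1 IH2 [RHS]mulrCA fockS/= !exprS; ring.
Qed.

(** [fock m ^+ 2] and [fock m.+1 ^+ 2] have the same integral, since their difference
    is, up to a constant, the derivative of [fock m * fock m.+1]. *)
Lemma fock_normalized m : \int[mu]_x (fock m x ^+ 2) = 1.
Proof.
have r : 1 / 4 < 1 / 2 :> R by lra.
have i n : mu.-integrable setT (EFin \o (fun x => fock n x ^+ 2)).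
  apply: (@gauss_rate_integrable _ (1/4 + 1/4)) => //; under eq_fun do rewrite expr2.
  by apply: gauss_rateM; exact: fock_gauss_rate.
elim: m => [|m <-].
  rewrite (_ : (fun _ => _) = (fun x => nf 0 ^+ 2 * expR (- 1 * x ^+ 2))).
    rewrite RintegralZl//; last exact: integrable_gauss.
    rewrite integral_gauss// divr1 /nf expr0 fact0 !mul1r exprVn sqr_sqrtr ?sqrtr_ge0//.
    by rewrite mulVf// gt_eqF// sqrtr_gt0 pi_gt0.
  apply/funext => x; rewrite /Defs.fock hermite0 mulr1 -/(nf 0) exprMn; congr (_ * _).
  by rewrite -expRM_natl; congr expR; field.
apply/eqP; rewrite eq_sym -subr_eq0 -RintegralB//; apply/eqP.
have s0 : sqrt 2 * sqrt m.+1%:R != 0 :> R by rewrite mulf_neq0// gt_eqF// sqrtr_gt0.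
apply: (mulfI s0); rewrite mulr0 -RintegralZl//; last first.
  by apply: (@integrableB _ _ _ mu setT measurableT (EFin \o _) (EFin \o _)); exact: i.
apply: (@Rintegral_derivative _ (1/4 + 1/4) (fun x => fock m x * fock m.+1 x)) => //.
- by apply: gauss_rateM; exact: fock_gauss_rate.
- apply: gauss_rateZ; apply: gauss_rateB; under eq_fun do rewrite expr2.
    by apply: gauss_rateM; exact: fock_gauss_rate.
  by apply: gauss_rateM; exact: fock_gauss_rate.
- move=> x; have := is_derive_fock m x; have := is_derive_fock_lower m.+1 x => ? ?.
  by apply: is_derive_eq; rewrite /GRing.scale/=; ring.
Qed.

End fock_functions.

(** * Exponential moments of the Fock functions *)

Section weighted.
Variable R : realType.
Local Notation mu := (@lebesgue_measure R).
Local Notation sqrt := Num.sqrt.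
Local Notation fock := (@fock R).

(** The left factor on the right is negative only where [x^2 < l / (1 - a^2)], and
    there the weight is bounded. *)
Lemma forbidden_region (a l x : R) : 0 <= a -> a < 1 -> 0 <= l ->
  - l * expR (a * l / (1 - a ^+ 2)) <=
  ((1 - a ^+ 2) * x ^+ 2 - l) * expR (a * x ^+ 2).
Proof.
move=> a0 a1 l0; have d0 : 0 < 1 - a ^+ 2 by nra.
have [h|h] := leP l ((1 - a ^+ 2) * x ^+ 2).
  rewrite (@le_trans _ _ 0)// ?mulr_ge0 ?expR_ge0 ?subr_ge0//.
  by rewrite mulNr oppr_le0 mulr_ge0// expR_ge0.
apply: (@le_trans _ _ (- l * expR (a * x ^+ 2))).
  rewrite !mulNr lerN2 ler_wpM2l// ler_expR -mulrA ler_wpM2l//.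
  by rewrite ler_pdivlMr// mulrC ltW.
by rewrite ler_wpM2r ?expR_ge0// lerDr mulr_ge0 ?sqr_ge0// ltW.
Qed.

(** An Agmon estimate.  The integral of
    [(h h' E)' = (h'^2 + h h'' + 2 a x h h') E], with [E = expR (a x^2)], vanishes.  As
    [h'' = (x^2 - 2m - 1) h] and [h'^2 + 2 a x h h' >= - a^2 x^2 h^2], it follows that
    [((1 - a^2) x^2 - 2m - 1) h^2 E] has a nonpositive integral.  Adding and
    subtracting [h^2 E] and applying [forbidden_region] gives the bound. *)
Lemma fock_weighted m (a : R) : 0 <= a -> a < 1 ->
  mu.-integrable setT (EFin \o (fun x => fock m x ^+ 2 * expR (a * x ^+ 2))) /\
  \int[mu]_x (fock m x ^+ 2 * expR (a * x ^+ 2)) <=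
    (2 * m%:R + 2) * expR (a * (2 * m%:R + 2) / (1 - a ^+ 2)).
Proof.
move=> a0 a1; pose c := 1 / 2 - (1 - a) / 8; pose l : R := 2 * m%:R + 2.
pose E := expR (a * l / (1 - a ^+ 2)).
pose h := fock m; pose h' x := x * fock m x - sqrt 2 * sqrt m.+1%:R * fock m.+1 x.
have l0 : 0 <= l by rewrite addr_ge0// mulr_ge0.
have cr : gauss_rate c h by apply: fock_gauss_rate; rewrite /c; lra.
have crX : gauss_rate c (fun x => x * h x).
  apply: (@gauss_rateX _ (1 / 2 - (1 - a) / 16)); first by rewrite /c; lra.
  by apply: fock_gauss_rate; lra.
have crh' : gauss_rate c h'.
  apply: gauss_rateB => //; apply: gauss_rateZ.
  by apply: fock_gauss_rate; rewrite /c; lra.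
have W : gauss_rate (- a) (fun x : R => expR (a * x ^+ 2)).
  by have := @gauss_rate_gauss R (- a); rewrite opprK.
have C f g : gauss_rate c f -> gauss_rate c g ->
    gauss_rate (c + c - a) (fun x => f x * g x * expR (a * x ^+ 2)).
  by move=> cf cg; apply: gauss_rateM => //; exact: gauss_rateM.
have c0 : 0 < c + c - a by rewrite /c; lra.
have i1 : mu.-integrable setT (EFin \o (fun x => h x ^+ 2 * expR (a * x ^+ 2))).
  apply: (gauss_rate_integrable c0); under eq_fun do rewrite expr2.
  exact: C.
have i0 : mu.-integrable setT (EFin \o (fun x => h x ^+ 2)).
  have cc : 0 < c + c by rewrite /c; lra.
  apply: (gauss_rate_integrable cc); under eq_fun do rewrite expr2.
  exact: gauss_rateM.
split => //.
(* the derivative of [h h' expR (a x^2)], given that [h'' = (x^2 - l + 1) h] *)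
pose f x := h' x * h' x * expR (a * x ^+ 2) +
  (((x * h x) * (x * h x) * expR (a * x ^+ 2)) +
   ((1 - l) * (h x * h x * expR (a * x ^+ 2)) +
   2 * a * ((x * h x) * h' x * expR (a * x ^+ 2)))).
have cf : gauss_rate (c + c - a) f.
  apply: gauss_rateD; first exact: C.
  apply: gauss_rateD; first exact: C.
  by apply: gauss_rateD; apply: gauss_rateZ; exact: C.
have f0 : \int[mu]_x f x = 0.
  apply: (@Rintegral_derivative _ _ (fun x => h x * h' x * expR (a * x ^+ 2)) f c0).
  - exact: C.
  - exact: cf.
  move=> x; have d1 : is_derive x 1 h (h' x) by exact: is_derive_fock.
  have d2 : is_derive x 1 h' ((x ^+ 2 - l + 1) * h x).
    have := is_derive_fock m x; have := is_derive_fock_lower m.+1 x => ? ?.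
    apply: is_derive_eq; rewrite /GRing.scale /=.
    rewrite /h /l.
    have s2 : sqrt 2 * sqrt 2 = 2 :> R by rewrite -expr2 sqr_sqrtr.
    have sm : sqrt m.+1%:R * sqrt m.+1%:R = m%:R + 1 :> R.
      by rewrite -expr2 sqr_sqrtr// natr1.
    have -> : 2 * m%:R + 2 = sqrt 2 * sqrt 2 * (sqrt m.+1%:R * sqrt m.+1%:R) :> R.
      by rewrite s2 sm; ring.
    by ring.
  by apply: is_derive_eq; rewrite /GRing.scale /= /f; ring.
have : \int[mu]_x (h x ^+ 2 * expR (a * x ^+ 2) - l * E * h x ^+ 2) <= \int[mu]_x f x.
  apply: le_Rintegral => //.
  - apply: (@integrableB _ _ _ mu setT measurableT (EFin \o _) (EFin \o _)) => //.
    exact: (integrableZl measurableT (l * E) i0).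
  - exact: (gauss_rate_integrable c0).
  move=> x _; have := forbidden_region x a0 a1 l0; rewrite -/E => fb.
  have h2 := sqr_ge0 (h x); have e0 := expR_ge0 (a * x ^+ 2).
  have := ler_wpM2r h2 fb.
  have := mulr_ge0 (sqr_ge0 (h' x + a * x * h x)) e0.
  rewrite /f -subr_ge0 => p1; rewrite -subr_ge0 => p2; rewrite -subr_ge0.
  apply: le_trans (addr_ge0 p1 p2) _.
  by rewrite le_eqVlt; apply/orP; left; apply/eqP; ring.
rewrite f0 RintegralB//; last exact: (integrableZl measurableT (l * E) i0).
by rewrite RintegralZl// fock_normalized mulr1 subr_le0.
Qed.

End weighted.

(** * Ladder relations and rotation invariance of the Wigner coefficients *)

Section complex_fourier.
Variable R : realType.
Local Notation mu := (@lebesgue_measure R).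
Local Notation sqrt := Num.sqrt.
Local Notation fock := (@fock R).

Definition ft (k : R -> R) (w : R) : R[i] := cosint k w +i* sinint k w.

Lemma complex_ext (x y : R[i]) :
  complex.Re x = complex.Re y -> complex.Im x = complex.Im y -> x = y.
Proof. by case: x y => [a b] [c d] /= -> ->. Qed.

Lemma ftD c k1 k2 w : 0 < c -> gauss_rate c k1 -> gauss_rate c k2 ->
  ft (fun x => k1 x + k2 x) w = ft k1 w + ft k2 w.
Proof.
move=> c0 h1 h2; apply: complex_ext => /=.
  rewrite -RintegralD//; try exact: (integrable_cos c0).
  by apply: eq_Rintegral => x _; rewrite mulrDr.
rewrite -RintegralD//; try exact: (integrable_sin c0).
by apply: eq_Rintegral => x _; rewrite mulrDr.
Qed.

Lemma ftZ c r k w : 0 < c -> gauss_rate c k ->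
  ft (fun x => r * k x) w = r%:C * ft k w.
Proof.
move=> c0 h; apply: complex_ext => /=.
  rewrite mul0r subr0 -RintegralZl//; last exact: (integrable_cos c0).
  by apply: eq_Rintegral => x _; rewrite mulrCA.
rewrite mul0r addr0 -RintegralZl//; last exact: (integrable_sin c0).
by apply: eq_Rintegral => x _; rewrite mulrCA.
Qed.

Lemma ft_derivative c k k' w : 0 < c -> gauss_rate c k -> gauss_rate c k' ->
  (forall x : R, is_derive x 1 k (k' x)) -> ft k' w = (0 -i* w) * ft k w.
Proof.
move=> c0 h h' d; apply: complex_ext => /=.
  by rewrite (cosint_derivative c0 h h' d) mul0r sub0r mulNr opprK.
by rewrite (sinint_derivative c0 h h' d) mul0r add0r.
Qed.

Definition cross_kernel (m n : nat) (q x : R) := fock m (q - x) * fock n (q + x).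

Definition cross m n q p := ft (cross_kernel m n q) (2 * p).

Lemma wigner_coefE m n q p : wigner_coef m n q p = (pi^-1)%:C * cross m n q p.
Proof.
rewrite /wigner_coef /cintegral; congr (_ * (_ +i* _)).
  by apply: eq_Rintegral => x _ /=; rewrite !mulr0 !subr0 !mulrA.
by apply: eq_Rintegral => x _ /=; rewrite !mulr0 !add0r !mulrA.
Qed.

Lemma cross_kernel_rate m n q c : c < 1 / 2 -> gauss_rate c (cross_kernel m n q).
Proof.
wlog c0 : c / 0 < c => [H c2|c2].
  have [|c0] := ltP 0 c; first by move=> c0; exact: H.
  by apply: (@gauss_rate_le _ (1 / 4)); [lra|apply: H; lra].
rewrite (_ : c = c / 2 + c / 2); last by lra.
by apply: gauss_rateM; [apply: gauss_rate_reflect|apply: gauss_rate_shift];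
  rewrite ?(ltW c0)//; exact: fock_gauss_rate.
Qed.

Let crk m n q : gauss_rate (1 / 4) (cross_kernel m n q).
Proof. by apply: cross_kernel_rate; lra. Qed.
Let q0 : 0 < 1 / 4 :> R. Proof. by []. Qed.

(** Multiplication by [2 (q + ip)] is, after integration by parts, the operator
    [2q - d/dx] applied to the kernel.  It lets [x + d/dx] act on the factor
    [h_m] and [x - d/dx] on [h_n], that is, it lowers [m] and raises [n]. *)
Lemma cross_raise_r m n q p :
  (sqrt m%:R)%:C * cross m.-1 n q p + (sqrt n.+1%:R)%:C * cross m n.+1 q p =
  (sqrt 2)%:C * (q +i* p) * cross m n q p.
Proof.
pose s : R := sqrt 2; have s0 : s != 0 by rewrite gt_eqF// sqrtr_gt0.
have ss : s * s = 2 by rewrite -expr2 sqr_sqrtr.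
pose k' x := 2 * q * cross_kernel m n q x +
  (- s * (sqrt m%:R * cross_kernel m.-1 n q x) +
   - s * (sqrt n.+1%:R * cross_kernel m n.+1 q x)).
have ck' : gauss_rate (1 / 4) k'.
  apply: gauss_rateD; first exact: gauss_rateZ.
  by apply: gauss_rateD; do 2 apply: gauss_rateZ.
have dk (x : R) : is_derive x 1 (cross_kernel m n q) (k' x).
  have := is_derive_fock_lower m (q - x); have := is_derive_fock n (q + x) => ? ?.
  rewrite /cross_kernel; apply: is_derive_eq.
  by rewrite /GRing.scale /= /k' /cross_kernel -/s; ring.
have := ft_derivative (2 * p) q0 (crk m n q) ck' dk.
rewrite (ftD _ q0)//; last 2 first.
  exact: gauss_rateZ.
  by apply: gauss_rateD; do 2 apply: gauss_rateZ.
rewrite (ftD _ q0); [|by do 2 apply: gauss_rateZ|by do 2 apply: gauss_rateZ].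
do 5 (rewrite (ftZ _ _ q0);
  last by exact: crk || (apply: gauss_rateZ; exact: crk)).
rewrite -!/(cross _ _ _ _) => E.
have sC : s%:C != 0 by rewrite eq_complex /= negb_and s0.
apply: (mulfI sC); rewrite !mulrA -(rmorphM (real_complex R)) ss.
move: E; case: (cross m n q p) => [a b]; case: (cross m.-1 n q p) => [c d].
case: (cross m n.+1 q p) => [e f] /eqP; rewrite eq_complex /= => /andP[/eqP E1 /eqP E2].
by apply: complex_ext => /=; lra.
Qed.

(** The conjugate relation: [2q + d/dx] raises [m] and lowers [n]. *)
Lemma cross_raise_l m n q p :
  (sqrt m.+1%:R)%:C * cross m.+1 n q p + (sqrt n%:R)%:C * cross m n.-1 q p =
  (sqrt 2)%:C * (q -i* p) * cross m n q p.
Proof.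
pose s : R := sqrt 2; have s0 : s != 0 by rewrite gt_eqF// sqrtr_gt0.
have ss : s * s = 2 by rewrite -expr2 sqr_sqrtr.
pose k' x := - (2 * q) * cross_kernel m n q x +
  (s * (sqrt m.+1%:R * cross_kernel m.+1 n q x) +
   s * (sqrt n%:R * cross_kernel m n.-1 q x)).
have ck' : gauss_rate (1 / 4) k'.
  apply: gauss_rateD; first exact: gauss_rateZ.
  by apply: gauss_rateD; do 2 apply: gauss_rateZ.
have dk (x : R) : is_derive x 1 (cross_kernel m n q) (k' x).
  have := is_derive_fock m (q - x); have := is_derive_fock_lower n (q + x) => ? ?.
  rewrite /cross_kernel; apply: is_derive_eq.
  by rewrite /GRing.scale /= /k' /cross_kernel -/s; ring.
have := ft_derivative (2 * p) q0 (crk m n q) ck' dk.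
rewrite (ftD _ q0)//; last 2 first.
  exact: gauss_rateZ.
  by apply: gauss_rateD; do 2 apply: gauss_rateZ.
rewrite (ftD _ q0); [|by do 2 apply: gauss_rateZ|by do 2 apply: gauss_rateZ].
do 5 (rewrite (ftZ _ _ q0);
  last by exact: crk || (apply: gauss_rateZ; exact: crk)).
rewrite -!/(cross _ _ _ _) => E.
have sC : s%:C != 0 by rewrite eq_complex /= negb_and s0.
apply: (mulfI sC); rewrite !mulrA -(rmorphM (real_complex R)) ss.
move: E; case: (cross m n q p) => [a b]; case: (cross m.+1 n q p) => [c d].
case: (cross m n.-1 q p) => [e f] /eqP; rewrite eq_complex /= => /andP[/eqP E1 /eqP E2].
by apply: complex_ext => /=; lra.
Qed.

Lemma cross_kernel00 q x :
  cross_kernel 0 0 q x = expR (- q ^+ 2) / sqrt pi * expR (- 1 * x ^+ 2).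
Proof.
have s0 : 0 < sqrt pi :> R by rewrite sqrtr_gt0 pi_gt0.
rewrite /cross_kernel /Defs.fock !hermite0 !mulr1 ?expr0 ?fact0 ?mul1r.
rewrite mulrACA -invfM -expr2 sqr_sqrtr ?ltW// -expRD mulrC mulrAC -expRD.
by congr (expR _ * _); field.
Qed.

Lemma cross00 q p : cross 0 0 q p = (expR (- (q ^+ 2 + p ^+ 2)))%:C.
Proof.
rewrite /cross (_ : cross_kernel 0 0 q =
    fun x => expR (- q ^+ 2) / sqrt pi * expR (- 1 * x ^+ 2)); last first.
  by apply/funext => x; exact: cross_kernel00.
rewrite (ftZ _ _ ltr01); last exact: gauss_rate_gauss.
rewrite /ft cosint_gauss sinint_gauss.
have s0 : sqrt pi != 0 :> R by rewrite gt_eqF// sqrtr_gt0 pi_gt0.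
apply: complex_ext => /=; last by rewrite mulr0 mul0r addr0.
by rewrite mul0r subr0 mulrA divfK// -expRD; congr expR; field.
Qed.

(** [cross m n] is [expR (- z^2)] times a polynomial that is homogeneous under
    rotations: each raising of [n] brings a factor [w], each raising of [m] a
    factor [w^*]. *)
Lemma cross_phase m n q p z (w : R[i]) : w * w^* = 1 -> (q +i* p) = w * z%:C ->
  cross m n q p = w ^+ n * w^* ^+ m * cross m n z 0.
Proof.
move=> w1 qp.
have s2 k : (sqrt k.+1%:R)%:C != 0 :> R[i].
  by rewrite eq_complex /= negb_and gt_eqF// sqrtr_gt0.
have qp' : (q -i* p) = w^* * z%:C.
  by move: qp; case: (w) => [a b] [-> ->]; apply: complex_ext => /=; ring.
elim: m n => [|m IHm] n.
  elim: n => [|n IHn].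
    rewrite !expr0 !mul1r !cross00 expr0n/= addr0; congr (expR (- _))%:C.
    move: w1 qp; case: (w) => [a b] /eqP; rewrite eq_complex /= => /andP[/eqP w1 _].
    move=> [-> ->]; rewrite !mulr0 subr0 add0r !exprMn -mulrDl.
    by rewrite (_ : a ^+ 2 + b ^+ 2 = 1) ?mul1r// -w1; ring.
  have e1 := cross_raise_r 0 n q p; have e2 := cross_raise_r 0 n z 0.
  rewrite sqrtr0 (mul0r (cross _ _ _ _)) add0r in e1.
  rewrite sqrtr0 (mul0r (cross _ _ _ _)) add0r in e2.
  rewrite IHn qp in e1.
  apply: (mulfI (s2 n)); rewrite e1 [RHS]mulrCA e2 exprS expr0 complexr0.
  by rewrite !mulr1; ring.
have e1 := cross_raise_l m n q p; have e2 := cross_raise_l m n z 0.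
apply: (mulfI (s2 m)); rewrite [RHS]mulrCA.
move/(canRL (addrK _)): e1 => ->; move/(canRL (addrK _)): e2 => ->.
rewrite qp' !IHm oppr0 complexr0; case: n => [|n]/=.
  by rewrite sqrtr0 !mul0r !subr0 exprS; ring.
have -> : w ^+ n * w^* ^+ m = w ^+ n.+1 * w^* ^+ m.+1.
  by rewrite !exprS -[LHS]mul1r -w1; ring.
rewrite !exprS; ring.
Qed.

Lemma norm_cross m n q p :
  `|cross m n q p| = `|cross m n (sqrt (q ^+ 2 + p ^+ 2)) 0|.
Proof.
set z := sqrt _; have z2 : z ^+ 2 = q ^+ 2 + p ^+ 2.
  by rewrite sqr_sqrtr// addr_ge0 ?sqr_ge0.
have [z0|z0] := eqVneq z 0.
  have : q ^+ 2 + p ^+ 2 == 0 by rewrite -z2 z0 expr0n.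
  rewrite paddr_eq0; [|exact: sqr_ge0..].
  rewrite !sqrf_eq0 => /andP[/eqP q00 /eqP p00].
  by rewrite q00 p00 z0.
pose w : R[i] := (q / z) +i* (p / z).
have w1 : w * w^* = 1.
  apply: complex_ext => /=; last by ring.
  transitivity ((q ^+ 2 + p ^+ 2) / z ^+ 2); first by field.
  by rewrite -z2 divff// sqrf_eq0.
have nw : `|w| = 1.
  by apply/eqP; rewrite -(@eqrXn2 _ 2)// expr1n sqr_normc w1.
have nw' : `|w^*| = 1 by rewrite normcJ.
rewrite (@cross_phase m n q p z w w1); last first.
  by apply: complex_ext => /=; rewrite mulr0 ?subr0 ?add0r divfK.
by rewrite !normrM !normrX nw nw' !expr1n !mul1r.
Qed.

End complex_fourier.

(** * A Gaussian bound on the Wigner coefficients *)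

Section bounds.
Variable R : realType.
Local Notation mu := (@lebesgue_measure R).
Local Notation sqrt := Num.sqrt.
Local Notation fock := (@fock R).

Lemma norm_Re_le (x : R[i]) (r : R) : `|x| <= r%:C -> `|complex.Re x| <= r.
Proof. by move=> h; rewrite -lecR; apply: le_trans h; exact: normc_ge_Re. Qed.

Lemma norm_Im_le (x : R[i]) (r : R) : `|x| <= r%:C -> `|complex.Im x| <= r.
Proof.
move=> h; rewrite -normrN -ReiNIm; apply: norm_Re_le.
by rewrite normrM (_ : `|'i%C| = 1) ?mulr1// normc_def /= expr0n expr1n add0r sqrtr1.
Qed.

Lemma norm_le_Re_Im (x : R[i]) (r s : R) :
  `|complex.Re x| <= r -> `|complex.Im x| <= s -> `|x| <= (r + s)%:C.
Proof.
move=> hr hs; rewrite normc_def lecR.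
have r0 := le_trans (normr_ge0 _) hr; have s0 := le_trans (normr_ge0 _) hs.
rewrite -(ler_pXn2r (_ : 0 < 2)%N) ?nnegrE ?sqrtr_ge0 ?addr_ge0//.
rewrite sqr_sqrtr ?addr_ge0 ?sqr_ge0//.
rewrite -(real_normK (num_real (complex.Re x))).
rewrite -(real_normK (num_real (complex.Im x))).
have a := normr_ge0 (complex.Re x); have b := normr_ge0 (complex.Im x).
nra.
Qed.

(* an upper bound on the square root of the bound of [fock_weighted] *)
Let M m (a : R) := (2 * m%:R + 2) * expR (a * (m%:R + 1) / (1 - a ^+ 2)).

Lemma fock_weighted_sqr m (a : R) : 0 <= a -> a < 1 ->
  \int[mu]_x (fock m x ^+ 2 * expR (a * x ^+ 2)) <= M m a ^+ 2.
Proof.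
move=> a0 a1; apply: le_trans (fock_weighted m a0 a1).2 _.
rewrite /M exprMn -expRM_natl; apply: ler_pM; rewrite ?expR_ge0//.
- by rewrite expr2 ler_peMr//; have : 0 <= m%:R :> R by []; lra.
- rewrite le_eqVlt; apply/orP; left; apply/eqP; congr expR; field.
  by rewrite gt_eqF//; nra.
Qed.

Lemma fock_weighted_shift m (a t : R) : 0 <= a -> a < 1 ->
  mu.-integrable setT
    (EFin \o (fun x => fock m (x + t) ^+ 2 * expR (a * (x + t) ^+ 2))) /\
  \int[mu]_x (fock m (x + t) ^+ 2 * expR (a * (x + t) ^+ 2)) <= M m a ^+ 2.
Proof.
move=> a0 a1; pose f x := fock m x ^+ 2 * expR (a * x ^+ 2).
pose c := 1 / 2 - (1 - a) / 8.
have cf : gauss_rate (c + c - a) f.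
  apply: gauss_rateM; last by have := @gauss_rate_gauss R (- a); rewrite opprK.
  under eq_fun do rewrite expr2.
  by apply: gauss_rateM; apply: fock_gauss_rate; rewrite /c; lra.
have c0 : 0 < c + c - a by rewrite /c; lra.
split.
  apply: (@gauss_rate_integrable _ ((c + c - a) / 2)); first by rewrite divr_gt0.
  under eq_fun do rewrite addrC.
  exact: (gauss_rate_shift t (ltW c0) cf).
rewrite (@Rintegral_shift _ f)//; first exact: fock_weighted_sqr.
- by case: cf.
- by move=> x; rewrite mulr_ge0 ?sqr_ge0 ?expR_ge0.
Qed.

(** As [(x - z)^2 + (x + z)^2 = 2 x^2 + 2 z^2], the weights
    [expR (a (x -+ z)^2 / 2)] given to the two factors multiply to at least [expR (a z^2)].  The weighted factors are
    then treated by Cauchy-Schwarz, in the form [2 F H <= F^2 + H^2] with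
    [F] and [H] normalized. *)
Lemma Rintegral_cross_kernel m n z (a : R) : 0 <= a -> a < 1 ->
  \int[mu]_x `|cross_kernel m n z x| <=
  (2 * m%:R + 2) * (2 * n%:R + 2) *
    expR (a * (m%:R + n%:R + 2) / (1 - a ^+ 2) - a * z ^+ 2).
Proof.
move=> a0 a1; pose U := M m a; pose V := M n a.
have U0 : 0 < U by rewrite mulr_gt0 ?expR_gt0//; have : 0 <= m%:R :> R by []; lra.
have V0 : 0 < V by rewrite mulr_gt0 ?expR_gt0//; have : 0 <= n%:R :> R by []; lra.
have [i1 b1] := fock_weighted_shift m (- z) a0 a1.
have [i2 b2] := fock_weighted_shift n z a0 a1.
pose f x := fock m (x + - z) ^+ 2 * expR (a * (x + - z) ^+ 2).
pose g x := fock n (x + z) ^+ 2 * expR (a * (x + z) ^+ 2).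
pose k := expR (- (a * z ^+ 2)) * (U * V) / 2.
have k0 : 0 <= k by rewrite divr_ge0// mulr_ge0 ?expR_ge0// mulr_ge0// ltW.
have i1' : mu.-integrable setT (EFin \o (fun x => (U ^+ 2)^-1 * f x)).
  exact: (integrableZl measurableT _ i1).
have i2' : mu.-integrable setT (EFin \o (fun x => (V ^+ 2)^-1 * g x)).
  exact: (integrableZl measurableT _ i2).
have i3 : mu.-integrable setT
    (EFin \o (fun x => (U ^+ 2)^-1 * f x + (V ^+ 2)^-1 * g x)).
  by apply: (@integrableD _ _ _ mu setT measurableT (EFin \o _) (EFin \o _)).
apply: (@le_trans _ _
  (\int[mu]_x (k * ((U ^+ 2)^-1 * f x + (V ^+ 2)^-1 * g x)))).
  apply: le_Rintegral => //.
  - apply: (@integrable_norm _ _ _ mu _ (cross_kernel m n z)).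
    by apply: (@gauss_rate_integrable _ (1 / 4)) => //; apply: cross_kernel_rate; lra.
  - exact: (integrableZl measurableT _ i3).
  move=> x _; rewrite /cross_kernel normrM.
  have -> : `|fock m (z - x)| = `|fock m (x + - z)|.
    by rewrite -opprB fock_opp normrM normrX normrN1 expr1n mul1r.
  rewrite (addrC z).
  pose F := `|fock m (x + - z)| * expR (a / 2 * (x + - z) ^+ 2) / U.
  pose H := `|fock n (x + z)| * expR (a / 2 * (x + z) ^+ 2) / V.
  have sq (y s W : R) : (W ^+ 2)^-1 * (y ^+ 2 * expR (a * s)) =
      (`|y| * expR (a / 2 * s) / W) ^+ 2.
    rewrite !exprMn exprVn real_normK ?num_real// -expRM_natl [LHS]mulrC.
    by congr (_ * expR _ * _); field.
  have Fs : (U ^+ 2)^-1 * f x = F ^+ 2 by exact: sq.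
  have Hs : (V ^+ 2)^-1 * g x = H ^+ 2 by exact: sq.
  rewrite Fs Hs.
  have e : expR (a / 2 * (x + - z) ^+ 2) * expR (a / 2 * (x + z) ^+ 2) *
      expR (- (a * z ^+ 2)) = expR (a * x ^+ 2).
    by rewrite -!expRD; congr expR; field.
  have e1 : 1 <= expR (a * x ^+ 2) by rewrite -expR0 ler_expR mulr_ge0 ?sqr_ge0.
  apply: (@le_trans _ _ (`|fock m (x + - z)| * `|fock n (x + z)| * expR (a * x ^+ 2))).
    by rewrite ler_peMr// mulr_ge0.
  have -> : `|fock m (x + - z)| * `|fock n (x + z)| * expR (a * x ^+ 2) =
      k * (2 * F * H).
    rewrite -e /k /F /H.
    move: (fock m _) (fock n _) (gt_eqF U0) (gt_eqF V0) => y y'.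
    by move=> u0 v0; field; rewrite u0 v0.
  rewrite ler_wpM2l//; have := sqr_ge0 (F - H); nra.
rewrite RintegralZl// RintegralD// !RintegralZl//.
have h1 : (U ^+ 2)^-1 * \int[mu]_x f x <= 1.
  by rewrite mulrC ler_pdivrMr ?mul1r ?exprn_gt0.
have h2 : (V ^+ 2)^-1 * \int[mu]_x g x <= 1.
  by rewrite mulrC ler_pdivrMr ?mul1r ?exprn_gt0.
apply: (@le_trans _ _ (k * (1 + 1))).
  by apply: ler_wpM2l; [exact: k0|exact: lerD].
have -> : a * (m%:R + n%:R + 2) / (1 - a ^+ 2) - a * z ^+ 2 =
    a * (m%:R + 1) / (1 - a ^+ 2) + (a * (n%:R + 1) / (1 - a ^+ 2) + - (a * z ^+ 2)).
  by field; rewrite gt_eqF//; nra.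
rewrite /k divfK// /U /V /M !expRD le_eqVlt; apply/orP; left; apply/eqP; ring.
Qed.

(** The parameter [a] is free: a small fixed [a] gives decay in [z], [a = 0] a
    polynomial bound, and [a = 1 / (m + n + 2)] integrability at a polynomial cost. *)
Lemma cross_bound m n q p (a : R) : 0 <= a -> a < 1 ->
  `|cross m n q p| <= ((2 * m%:R + 2) * (2 * n%:R + 2) *
    expR (a * (m%:R + n%:R + 2) / (1 - a ^+ 2) - a * (q ^+ 2 + p ^+ 2)))%:C.
Proof.
move=> a0 a1; rewrite norm_cross; set z := sqrt _.
have -> : q ^+ 2 + p ^+ 2 = z ^+ 2 by rewrite sqr_sqrtr// addr_ge0 ?sqr_ge0.
rewrite /cross mulr0 /ft sinint0.
have -> : cosint (cross_kernel m n z) 0 = \int[mu]_x cross_kernel m n z x.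
  by apply: eq_Rintegral => x _; rewrite mul0r cos0 mul1r.
rewrite complexr0 normc_def /= expr0n addr0 sqrtr_sqr lecR.
apply: le_trans (Rintegral_cross_kernel m n z a0 a1).
apply: le_normr_Rintegral => //.
by apply: (@gauss_rate_integrable _ (1 / 4)) => //; apply: cross_kernel_rate; lra.
Qed.

End bounds.

(** * Fourier inversion in the momentum variable *)

Section inversion.
Variable R : realType.
Local Notation mu := (@lebesgue_measure R).
Local Notation sqrt := Num.sqrt.
Local Notation fock := (@fock R).
Implicit Types F : R -> R[i].

Definition cgauss_rate c F := gauss_rate c (fun p => complex.Re (F p)) /\
  gauss_rate c (fun p => complex.Im (F p)).

(** Fourier integral of a complex-valued function, defined through real ones;
    [cftE] identifies it. *)
Definition cft F (w : R) : R[i] :=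
  ft (fun p => complex.Re (F p)) w + 'i%C * ft (fun p => complex.Im (F p)) w.

Lemma cgauss_rateD c F G : cgauss_rate c F -> cgauss_rate c G ->
  cgauss_rate c (fun p => F p + G p).
Proof.
move=> [f1 f2] [g1 g2]; split.
  by under eq_fun do rewrite raddfD; exact: gauss_rateD.
by under eq_fun do rewrite raddfD; exact: gauss_rateD.
Qed.

Let ReM (x y : R[i]) : complex.Re (x * y) =
  complex.Re x * complex.Re y + - complex.Im x * complex.Im y.
Proof. by case: x y => [a b] [c d] /=; rewrite mulNr. Qed.

Let ImM (x y : R[i]) : complex.Im (x * y) =
  complex.Im x * complex.Re y + complex.Re x * complex.Im y.
Proof. by case: x y => [a b] [c d] /=; rewrite addrC. Qed.

Lemma cgauss_rateZ c (z : R[i]) F : cgauss_rate c F -> cgauss_rate c (fun p => z * F p).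
Proof.
move=> [f1 f2]; split.
  by under eq_fun do rewrite ReM; apply: gauss_rateD; exact: gauss_rateZ.
by under eq_fun do rewrite ImM; apply: gauss_rateD; exact: gauss_rateZ.
Qed.

Lemma cftD c F G w : 0 < c -> cgauss_rate c F -> cgauss_rate c G ->
  cft (fun p => F p + G p) w = cft F w + cft G w.
Proof.
move=> c0 [f1 f2] [g1 g2]; rewrite /cft.
under eq_fun do rewrite raddfD.
under [X in _ + _ * ft X _]eq_fun do rewrite raddfD.
by rewrite (ftD _ c0 f1 g1) (ftD _ c0 f2 g2) mulrDr addrACA.
Qed.

Lemma cftZ c (z : R[i]) F w : 0 < c -> cgauss_rate c F ->
  cft (fun p => z * F p) w = z * cft F w.
Proof.
move=> c0 [f1 f2]; rewrite /cft.
under eq_fun do rewrite ReM.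
under [X in _ + _ * ft X _]eq_fun do rewrite ImM.
rewrite (ftD _ c0); [|exact: gauss_rateZ..].
rewrite (ftD _ c0); [|exact: gauss_rateZ..].
rewrite (ftZ _ _ c0 f1) (ftZ _ _ c0 f2) (ftZ _ _ c0 f1) (ftZ _ _ c0 f2).
move: (ft _ _) (ft _ _) => B A; case: z => [a b] /=.
rewrite [a +i* b]complexE /=.
have i2 : 'i%C * 'i%C = - 1 :> R[i] by rewrite -expr2 sqr_i.
rewrite rmorphN; transitivity ('i%C * 'i%C * (b%:C * B) +
  (a%:C * A + 'i%C * (b%:C * A + a%:C * B))).
  by rewrite i2; ring.
ring.
Qed.

Lemma cft_derivative c F F' w : 0 < c -> cgauss_rate c F -> cgauss_rate c F' ->
  (forall p : R, is_derive p 1 (fun p => complex.Re (F p)) (complex.Re (F' p))) ->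
  (forall p : R, is_derive p 1 (fun p => complex.Im (F p)) (complex.Im (F' p))) ->
  cft F' w = (0 -i* w) * cft F w.
Proof.
move=> c0 [f1 f2] [g1 g2] d1 d2; rewrite /cft.
by rewrite (ft_derivative w c0 f1 g1 d1) (ft_derivative w c0 f2 g2 d2); ring.
Qed.

Lemma cftE c F w : 0 < c -> cgauss_rate c F ->
  cft F w = cintegral mu (fun p => expi (w * p) * F p).
Proof.
move=> c0 [f1 f2].
have i1 := integrable_cos c0 f1 w; have i2 := integrable_sin c0 f1 w.
have i3 := integrable_cos c0 f2 w; have i4 := integrable_sin c0 f2 w.
apply: complex_ext => /=.
  rewrite mul0r mul1r add0r -RintegralB//.
  by apply: eq_Rintegral => p _; rewrite ReM /= mulNr.
rewrite mul0r mul1r add0r -RintegralD//.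
by apply: eq_Rintegral => p _; rewrite ImM.
Qed.

Local Notation K := (@cross_kernel R).

Let q14 : 0 < 1 / 4 :> R. Proof. by []. Qed.

Let crk m n q : gauss_rate (1 / 4) (K m n q).
Proof. by apply: cross_kernel_rate; lra. Qed.

Lemma is_derive_Re_cross m n q (p : R) :
  is_derive p 1 (fun p => complex.Re (cross m n q p))
    (complex.Re (2%:R * 'i%C * ft (fun x => x * K m n q x) (2 * p))).
Proof.
have := is_derive_cosint q14 (crk m n q) (2 * p) => d.
have e : is_derive p 1 (fun p : R => 2 * p) 2.
  by apply: is_derive_eq; rewrite /GRing.scale /= mulr1.
apply: (is_derive_eq (is_derive1_comp d e)) => /=; ring.
Qed.

Lemma is_derive_Im_cross m n q (p : R) :
  is_derive p 1 (fun p => complex.Im (cross m n q p))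
    (complex.Im (2%:R * 'i%C * ft (fun x => x * K m n q x) (2 * p))).
Proof.
have := is_derive_sinint q14 (crk m n q) (2 * p) => d.
have e : is_derive p 1 (fun p : R => 2 * p) 2.
  by apply: is_derive_eq; rewrite /GRing.scale /= mulr1.
apply: (is_derive_eq (is_derive1_comp d e)) => /=; ring.
Qed.

Lemma cross_rate m n q : cgauss_rate (1 / 4) (cross m n q).
Proof.
have a0 : 0 <= 1 / 4 :> R by [].
have a1 : 1 / 4 < 1 :> R by lra.
pose C : R := (2 * m%:R + 2) * (2 * n%:R + 2) *
  expR (1 / 4 * (m%:R + n%:R + 2) / (1 - (1 / 4) ^+ 2) - 1 / 4 * q ^+ 2).
split.
  split.
    move=> p; apply: differentiable_continuous; apply/derivable1_diffP.
    by have := is_derive_Re_cross m n q p => d; apply: ex_derive.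
  exists C => p; apply: le_trans (norm_Re_le (cross_bound m n q p a0 a1)) _.
  rewrite le_eqVlt; apply/orP; left; apply/eqP; rewrite /C -[RHS]mulrA -expRD.
  by congr (_ * expR _); field.
split.
  move=> p; apply: differentiable_continuous; apply/derivable1_diffP.
  by have := is_derive_Im_cross m n q p => d; apply: ex_derive.
exists C => p; apply: le_trans (norm_Im_le (cross_bound m n q p a0 a1)) _.
rewrite le_eqVlt; apply/orP; left; apply/eqP; rewrite /C -[RHS]mulrA -expRD.
by congr (_ * expR _); field.
Qed.

Lemma fock_mulX m x : sqrt 2 * (x * fock m x) =
  sqrt m.+1%:R * fock m.+1 x + sqrt m%:R * fock m.-1 x.
Proof. by rewrite fockS subrK mulrA. Qed.

Let s2V : (sqrt 2)^-1 * sqrt 2 = 1 :> R.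
Proof. by rewrite mulVf// gt_eqF// sqrtr_gt0. Qed.

Let ftX_r m n q w : ft (fun x => x * K m n q x) w =
  (sqrt 2)^-1%:C * ((sqrt n.+1%:R)%:C * ft (K m n.+1 q) w +
    (sqrt n%:R)%:C * ft (K m n.-1 q) w) + (- q)%:C * ft (K m n q) w.
Proof.
rewrite -!(ftZ _ _ q14)// -(ftD _ q14); [|exact: gauss_rateZ..].
rewrite -(ftZ _ _ q14); last by apply: gauss_rateD; exact: gauss_rateZ.
rewrite -(ftD _ q14); last 2 first.
- by apply: gauss_rateZ; apply: gauss_rateD; exact: gauss_rateZ.
- exact: gauss_rateZ.
congr ft; apply/funext => x; rewrite /cross_kernel.
have e := fock_mulX n (q + x).
move: (fock m _) (fock n _) (fock n.+1 _) (fock n.-1 _) e => A B B1 B2 e.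
transitivity ((sqrt 2)^-1 * (A * (sqrt 2 * ((q + x) * B))) + - q * (A * B)).
  transitivity ((sqrt 2)^-1 * sqrt 2 * (A * ((q + x) * B)) + - q * (A * B)); last by ring.
  by rewrite s2V; ring.
by rewrite e; ring.
Qed.

Let ftX_l m n q w : ft (fun x => x * K m n q x) w =
  - (sqrt 2)^-1%:C * ((sqrt m.+1%:R)%:C * ft (K m.+1 n q) w +
    (sqrt m%:R)%:C * ft (K m.-1 n q) w) + q%:C * ft (K m n q) w.
Proof.
rewrite -rmorphN -!(ftZ _ _ q14)// -(ftD _ q14); [|exact: gauss_rateZ..].
rewrite -(ftZ _ _ q14); last by apply: gauss_rateD; exact: gauss_rateZ.
rewrite -(ftD _ q14); last 2 first.
- by apply: gauss_rateZ; apply: gauss_rateD; exact: gauss_rateZ.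
- exact: gauss_rateZ.
congr ft; apply/funext => x; rewrite /cross_kernel.
have e := fock_mulX m (q - x).
move: (fock n _) (fock m _) (fock m.+1 _) (fock m.-1 _) e => A B B1 B2 e.
transitivity (- (sqrt 2)^-1 * (A * (sqrt 2 * ((q - x) * B))) + q * (B * A)).
  transitivity (- ((sqrt 2)^-1 * sqrt 2) * (A * ((q - x) * B)) + q * (B * A)); last by ring.
  by rewrite s2V; ring.
by rewrite e; ring.
Qed.

Let cft_X m n q v J : (forall p, J p = ft (fun x => x * K m n q x) (2 * p)) ->
  cgauss_rate (1 / 4) J -> cft J (- v) = (v / 2)%:C * cft (cross m n q) (- v).
Proof.
move=> JE rJ.
have i2 : (2%:R * 'i%C : R[i]) != 0.
  by rewrite mulf_neq0 ?pnatr_eq0// eq_complex /= negb_and oner_eq0 orbT.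
apply: (mulfI i2).
rewrite -(cftZ _ _ q14 rJ).
rewrite (_ : cft _ _ = (0 -i* - v) * cft (cross m n q) (- v)); last first.
  apply: (cft_derivative _ q14 (cross_rate m n q)).
  - exact: cgauss_rateZ.
  - by move=> p; rewrite JE; exact: is_derive_Re_cross.
  - by move=> p; rewrite JE; exact: is_derive_Im_cross.
by rewrite mulrA; congr (_ * _); apply: complex_ext => /=; field.
Qed.

Let s2C : (sqrt 2)%:C * ((sqrt 2)^-1)%:C = 1 :> R[i].
Proof. by rewrite -rmorphM /= mulrC s2V. Qed.

Let cft_r m n q v : (sqrt n.+1%:R)%:C * cft (cross m n.+1 q) (- v) =
  (sqrt 2 * (q + v / 2))%:C * cft (cross m n q) (- v) -
  (sqrt n%:R)%:C * cft (cross m n.-1 q) (- v).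
Proof.
pose J p := ((sqrt 2)^-1)%:C * ((sqrt n.+1%:R)%:C * cross m n.+1 q p +
    (sqrt n%:R)%:C * cross m n.-1 q p) + (- q)%:C * cross m n q p.
have r1 k l a : cgauss_rate (1 / 4) (fun p => a%:C * cross k l q p).
  exact/cgauss_rateZ/cross_rate.
have := @cft_X m n q v J (fun p => esym (ftX_r m n q (2 * p))).
rewrite (cftD _ q14); [|by apply: cgauss_rateZ; apply: cgauss_rateD; exact: r1|exact: r1].
rewrite (cftZ ((sqrt 2)^-1)%:C _ q14); last by apply: cgauss_rateD; exact: r1.
rewrite (cftD _ q14)// !(cftZ _ _ q14); try exact: cross_rate.
move=> /(_ (cgauss_rateD (cgauss_rateZ _ (cgauss_rateD (r1 _ _ _) (r1 _ _ _))) (r1 _ _ _))).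
move: (cft (cross m n.+1 q) _) (cft (cross m n.-1 q) _) (cft (cross m n q) _) => u u' u0 e.
rewrite rmorphM rmorphD /= -[(sqrt 2)%:C * _ * _]mulrA mulrDl -e rmorphN.
move: (((sqrt 2)^-1)%:C) s2C => t st.
transitivity ((sqrt 2)%:C * t *
  ((sqrt n.+1%:R)%:C * u + (sqrt n%:R)%:C * u') - (sqrt n%:R)%:C * u').
  by rewrite st; ring.
by ring.
Qed.

Let cft_l m n q v : (sqrt m.+1%:R)%:C * cft (cross m.+1 n q) (- v) =
  (sqrt 2 * (q - v / 2))%:C * cft (cross m n q) (- v) -
  (sqrt m%:R)%:C * cft (cross m.-1 n q) (- v).
Proof.
pose J p := - ((sqrt 2)^-1)%:C * ((sqrt m.+1%:R)%:C * cross m.+1 n q p +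
    (sqrt m%:R)%:C * cross m.-1 n q p) + q%:C * cross m n q p.
have r1 k l a : cgauss_rate (1 / 4) (fun p => a%:C * cross k l q p).
  exact/cgauss_rateZ/cross_rate.
have := @cft_X m n q v J (fun p => esym (ftX_l m n q (2 * p))).
rewrite (cftD _ q14); [|by apply: cgauss_rateZ; apply: cgauss_rateD; exact: r1|exact: r1].
rewrite (cftZ (- ((sqrt 2)^-1)%:C) _ q14); last by apply: cgauss_rateD; exact: r1.
rewrite (cftD _ q14)// !(cftZ _ _ q14); try exact: cross_rate.
move=> /(_ (cgauss_rateD (cgauss_rateZ _ (cgauss_rateD (r1 _ _ _) (r1 _ _ _))) (r1 _ _ _))).
move: (cft (cross m.+1 n q) _) (cft (cross m.-1 n q) _) (cft (cross m n q) _) => u u' u0 e.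
rewrite rmorphM rmorphB /= -[(sqrt 2)%:C * _ * _]mulrA mulrBl -e.
move: (((sqrt 2)^-1)%:C) s2C => t st.
transitivity ((sqrt 2)%:C * t *
  ((sqrt m.+1%:R)%:C * u + (sqrt m%:R)%:C * u') - (sqrt m%:R)%:C * u').
  by rewrite st; ring.
by ring.
Qed.

Lemma three_term_unique (A : R) (u w : nat -> R[i]) :
  (forall n, (sqrt n.+1%:R)%:C * u n.+1 = A%:C * u n - (sqrt n%:R)%:C * u n.-1) ->
  (forall n, (sqrt n.+1%:R)%:C * w n.+1 = A%:C * w n - (sqrt n%:R)%:C * w n.-1) ->
  u 0 = w 0 -> forall n, u n = w n.
Proof.
move=> hu hw e0 n.
have s2 k : (sqrt k.+1%:R)%:C != 0 :> R[i].
  by rewrite eq_complex /= negb_and gt_eqF// sqrtr_gt0.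
suff H k : u k = w k /\ u k.+1 = w k.+1 by apply: (H n).1.
elim: k => [|k [IH1 IH2]]; split => //.
  by apply: (mulfI (s2 0%N)); rewrite (hu 0%N) (hw 0%N) e0.
by apply: (mulfI (s2 k.+1)); rewrite hu hw /= IH1 IH2.
Qed.

(** In [p], multiplying the kernel by [x] amounts to differentiating [cross m n q],
    hence to multiplying its transform by [v/2] ([cft_X]).  So the two sides satisfy
    the same three-term recurrences in [m] and in [n], those of the Fock functions
    at [q - v/2] and [q + v/2]. *)
Theorem cross_inversion m n q v :
  cft (cross m n q) (- v) = (pi * K m n q (v / 2))%:C.
Proof.
have kr k l : (sqrt l.+1%:R)%:C * (pi * K k l.+1 q (v / 2))%:C =
    (sqrt 2 * (q + v / 2))%:C * (pi * K k l q (v / 2))%:C -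
    (sqrt l%:R)%:C * (pi * K k l.-1 q (v / 2))%:C.
  rewrite -!rmorphM -rmorphB; congr _%:C; rewrite /cross_kernel.
  have e := fockS l (q + v / 2).
  by rewrite mulrCA [X in _ * X]mulrCA e; ring.
have kl k l : (sqrt k.+1%:R)%:C * (pi * K k.+1 l q (v / 2))%:C =
    (sqrt 2 * (q - v / 2))%:C * (pi * K k l q (v / 2))%:C -
    (sqrt k%:R)%:C * (pi * K k.-1 l q (v / 2))%:C.
  rewrite -!rmorphM -rmorphB; congr _%:C; rewrite /cross_kernel.
  have e := fockS k (q - v / 2).
  by rewrite mulrCA [X in _ * X]mulrA e; ring.
apply: (three_term_unique (u := fun m => cft (cross m n q) (- v))
  (w := fun m => (pi * K m n q (v / 2))%:C) (fun k => cft_l k n q v) (kl^~ n)).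
apply: (three_term_unique (u := fun n => cft (cross 0 n q) (- v))
  (w := fun n => (pi * K 0 n q (v / 2))%:C) (fun k => cft_r 0 k q v) (kr 0%N)).
rewrite /cft.
have -> : (fun p => complex.Re (cross 0 0 q p)) =
    (fun p => expR (- q ^+ 2) * expR (- 1 * p ^+ 2)).
  by apply/funext => p; rewrite cross00 /= -expRD; congr expR; ring.
have -> : (fun p => complex.Im (cross 0 0 q p)) = (fun p => 0 * expR (- 1 * p ^+ 2)).
  by apply/funext => p; rewrite cross00 /= mul0r.
rewrite !(ftZ _ _ ltr01); try exact: gauss_rate_gauss.
rewrite mul0r mulr0 addr0 /ft cosint_gauss sinint_gauss complexr0 -rmorphM; congr _%:C.
rewrite cross_kernel00 !mulrA; congr (_ * expR _); last by field.
have s0 : sqrt pi != 0 :> R by rewrite gt_eqF// sqrtr_gt0 pi_gt0.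
have sp : sqrt pi * sqrt pi = pi :> R by rewrite -expr2 sqr_sqrtr// pi_ge0.
by rewrite -[X in X * _ / _]sp; field.
Qed.

End inversion.

(** * Fourier transform on phase space *)

Section phase_space.
Variable R : realType.
Local Notation mu := (@lebesgue_measure R).
Local Notation mu2 := (mu \x mu)%E.
Local Notation sqrt := Num.sqrt.

Definition cmeasurable d (T : measurableType d) (F : T -> R[i]) :=
  measurable_fun setT (fun z => complex.Re (F z)) /\
  measurable_fun setT (fun z => complex.Im (F z)).

Lemma cmeasurableM d (T : measurableType d) (F G : T -> R[i]) :
  cmeasurable F -> cmeasurable G -> cmeasurable (fun z => F z * G z).
Proof.
move=> [f1 f2] [g1 g2]; split.
  rewrite (_ : (fun _ => _) = (fun z => complex.Re (F z) * complex.Re (G z) -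
      complex.Im (F z) * complex.Im (G z))).
    by apply: measurable_funB; exact: measurable_funM.
  by apply/funext => z; case: (F z) (G z) => [a b] [c d'].
rewrite (_ : (fun _ => _) = (fun z => complex.Re (F z) * complex.Im (G z) +
    complex.Im (F z) * complex.Re (G z))).
  by apply: measurable_funD; exact: measurable_funM.
by apply/funext => z; case: (F z) (G z) => [a b] [c d'].
Qed.

Lemma cmeasurableB d (T : measurableType d) (F G : T -> R[i]) :
  cmeasurable F -> cmeasurable G -> cmeasurable (fun z => F z - G z).
Proof.
move=> [f1 f2] [g1 g2]; split.
  by under eq_fun do rewrite raddfB; exact: measurable_funB.
by under eq_fun do rewrite raddfB; exact: measurable_funB.
Qed.

Lemma cmeasurable_cst d (T : measurableType d) (c : R[i]) :
  cmeasurable (fun _ : T => c).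
Proof. by split; exact: measurable_cst. Qed.

(** By the ladder relations, [cross m n] is a polynomial in [q] and [p] times a
    Gaussian. *)
Lemma cmeasurable_cross m n : cmeasurable (fun z : R * R => cross m n z.1 z.2).
Proof.
have s2 k : (sqrt k.+1%:R)%:C != 0 :> R[i].
  by rewrite eq_complex /= negb_and gt_eqF// sqrtr_gt0.
elim: m n => [|m IHm] n.
  elim: n => [|n IHn].
    split; last first.
      by under eq_fun do rewrite cross00; exact: measurable_cst.
    under eq_fun do rewrite cross00 /=.
    apply: measurableT_comp => //; apply: measurableT_comp => //.
    by apply: measurable_funD; apply: measurable_funX => //;
       (exact: measurable_fst || exact: measurable_snd).
  rewrite (_ : (fun _ => _) = (fun z => ((sqrt n.+1%:R)%:C^-1 * (sqrt 2)%:C) *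
      ((z.1 +i* z.2) * cross 0 n z.1 z.2))).
    apply: cmeasurableM; first exact: cmeasurable_cst.
    apply: cmeasurableM => //.
    by split; [exact: measurable_fst|exact: measurable_snd].
  apply/funext => z; have := cross_raise_r 0 n z.1 z.2.
  by rewrite sqrtr0 mul0r add0r -!mulrA => <-; rewrite mulKf.
rewrite (_ : (fun _ => _) = (fun z => (sqrt m.+1%:R)%:C^-1 * ((sqrt 2)%:C *
      ((z.1 -i* z.2) * cross m n z.1 z.2) - (sqrt n%:R)%:C * cross m n.-1 z.1 z.2))).
  apply: cmeasurableM; first exact: cmeasurable_cst.
  apply: cmeasurableB; apply: cmeasurableM => //; try exact: cmeasurable_cst.
  apply: cmeasurableM => //; split; first exact: measurable_fst.
  by apply: measurableT_comp => //; exact: measurable_snd.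
apply/funext => z; have := cross_raise_l m n z.1 z.2.
by move=> e; rewrite [(sqrt 2)%:C * (_ * _)]mulrA -e addrK mulKf.
Qed.

Lemma integrable_gauss2 (f : R * R -> R) C a : 0 < a -> measurable_fun setT f ->
  (forall z, `|f z| <= C * expR (- a * (z.1 ^+ 2 + z.2 ^+ 2))) ->
  mu2.-integrable setT (EFin \o f) /\
  (\int[mu2]_z `|(f z)%:E| <= (C * (pi / a))%:E)%E.
Proof.
move=> a0 mf fC; have C0 : 0 <= C.
  have := le_trans (normr_ge0 _) (fC (0, 0)).
  by rewrite /= expr0n addr0 mulr0 expR0 mulr1.
pose g (z : R * R) : \bar R := (C * expR (- a * (z.1 ^+ 2 + z.2 ^+ 2)))%:E.
have mg : measurable_fun setT g.
  apply/measurable_EFinP; apply: measurable_funM => //.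
  apply: measurableT_comp => //; apply: measurable_funM => //.
  by apply: measurable_funD; apply: measurable_funX => //;
     (exact: measurable_fst || exact: measurable_snd).
have g0 z : (0 <= g z)%E by rewrite lee_fin mulr_ge0// expR_ge0.
have s0 : 0 <= pi / a by rewrite divr_ge0 ?pi_ge0// ltW.
have E1 : (\int[mu]_x (expR (- a * x ^+ 2))%:E = (sqrt (pi / a))%:E)%E.
  rewrite -integral_gauss// /Rintegral fineK//.
  by apply: integrable_fin_num => //; exact: integrable_gauss.
have gi : (\int[mu2]_z g z = (C * (pi / a))%:E)%E.
  rewrite (@fubini_tonelli1 _ _ _ _ R mu mu g mg g0) /fubini_F.
  transitivity (\int[mu]_x ((C * sqrt (pi / a))%:E * (expR (- a * x ^+ 2))%:E))%E.
    apply: eq_integral => x _; rewrite /g /=.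
    transitivity
      (\int[mu]_y ((C * expR (- a * x ^+ 2))%:E * (expR (- a * y ^+ 2))%:E))%E.
      by apply: eq_integral => y _; rewrite -EFinM mulrDr expRD mulrA.
    rewrite integralZl//; last exact: integrable_gauss.
    by rewrite E1 -!EFinM mulrAC.
  rewrite integralZl//; last exact: integrable_gauss.
  by rewrite E1 -EFinM -mulrA -expr2 sqr_sqrtr.
have le : (\int[mu2]_z `|(f z)%:E| <= (C * (pi / a))%:E)%E.
  rewrite -gi; apply: ge0_le_integral => //.
  - by apply: measurableT_comp => //; exact/measurable_EFinP.
  - by move=> z _; rewrite lee_fin.
split => //; apply/integrableP; split; first exact/measurable_EFinP.
by apply: le_lt_trans le _; exact: ltry.
Qed.

Lemma Rintegral_fubini (f : R * R -> R) :
  mu2.-integrable setT (EFin \o f) ->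
  (forall q, mu.-integrable setT (EFin \o (fun p => f (q, p)))) ->
  \int[mu2]_z f z = \int[mu]_q \int[mu]_p f (q, p).
Proof.
move=> i1 i2; rewrite /Rintegral; congr fine.
rewrite -(integral12_prod_meas1 i1); apply: eq_integral => q _.
rewrite /fubini_F [RHS]fineK//; exact: (integrable_fin_num _ (i2 q)).
Qed.

Lemma ftE k w : ft k w = cintegral mu (fun x => expi (w * x) * (k x)%:C).
Proof.
apply: complex_ext => /=.
  by apply: eq_Rintegral => x _ /=; rewrite mulr0 subr0.
by apply: eq_Rintegral => x _ /=; rewrite mulr0 add0r.
Qed.

Lemma expiD (s t : R) : expi (s + t) = expi s * expi t.
Proof. by rewrite /expi cosD sinD; apply: complex_ext => //=; rewrite addrC mulrC. Qed.

Lemma norm_expi (t : R) : `|expi t| = 1.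
Proof. by rewrite normc_def /= cos2Dsin2 sqrtr1. Qed.

Lemma cmeasurable_character (u v : R) :
  cmeasurable (fun z : R * R => expi (- (u * z.1 + v * z.2))).
Proof.
have m : measurable_fun setT (fun z : R * R => - (u * z.1 + v * z.2)).
  apply: measurableT_comp => //; apply: measurable_funD; apply: measurable_funM => //;
    (exact: measurable_fst || exact: measurable_snd).
split => /=.
  by apply: measurableT_comp => //; apply: continuous_measurable_fun; exact: continuous_cos.
by apply: measurableT_comp => //; apply: continuous_measurable_fun; exact: continuous_sin.
Qed.

(** After the inner inversion the kernel at [v/2] is left,
    [h_m(q - v/2) h_n(q + v/2) = (-1)^m h_m(v/2 - q) h_n(v/2 + q)], which is again a
    kernel, with centre [v/2] and variable [q]. *)
Lemma fourier2_cross m n (u v : R) :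
  fourier2 (cross m n) u v = (pi * (-1) ^+ m)%:C * cross m n (v / 2) (- u / 2).
Proof.
pose F (z : R * R) := expi (- (u * z.1 + v * z.2)) * cross m n z.1 z.2.
have [mF1 mF2] : cmeasurable F.
  apply: cmeasurableM; [exact: cmeasurable_character|exact: cmeasurable_cross].
have q14 : 0 < 1 / 4 :> R by []. have q1 : 1 / 4 < 1 :> R by lra.
pose C : R := (2 * m%:R + 2) * (2 * n%:R + 2) *
  expR (1 / 4 * (m%:R + n%:R + 2) / (1 - (1 / 4) ^+ 2)).
have FC z : `|F z| <= (C * expR (- (1 / 4) * (z.1 ^+ 2 + z.2 ^+ 2)))%:C.
  rewrite normrM norm_expi [leLHS]mul1r.
  apply: (le_trans (cross_bound m n z.1 z.2 (ltW q14) q1)).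
  by rewrite lecR /C -[leRHS]mulrA -expRD mulNr.
have FE q p : F (q, p) = expi ((- v) * p) * (expi ((- u) * q) * cross m n q p).
  by rewrite mulrA -expiD; congr (expi _ * _) => /=; ring.
have cr q : cgauss_rate (1 / 4) (fun p => expi ((- u) * q) * cross m n q p).
  exact/cgauss_rateZ/cross_rate.
have crF q : cgauss_rate (1 / 4) (fun p => F (q, p)).
  have [[c1 _] [c2 _]] := cr q.
  have [c3 _] := gauss_rate_cos (- v); have [c4 _] := gauss_rate_sin (- v).
  split; split.
  - move=> p; under eq_fun do rewrite FE /=.
    by apply: cvgB; apply: cvgM; [exact: c3|exact: c1|exact: c4|exact: c2].
  - exists (C * expR (- (1 / 4) * q ^+ 2)) => p.
    apply: le_trans (norm_Re_le (FC (q, p))) _.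
    by rewrite -mulrA -expRD mulrDr.
  - move=> p; under eq_fun do rewrite FE /=.
    by apply: cvgD; apply: cvgM; [exact: c3|exact: c2|exact: c4|exact: c1].
  - exists (C * expR (- (1 / 4) * q ^+ 2)) => p.
    apply: le_trans (norm_Im_le (FC (q, p))) _.
    by rewrite -mulrA -expRD mulrDr.
have inner q : cintegral mu (fun p => F (q, p)) =
    expi ((- u) * q) * ((pi * (-1) ^+ m) * cross_kernel m n (v / 2) q)%:C.
  have -> : (fun p => F (q, p)) =
      (fun p => expi ((- v) * p) * (expi ((- u) * q) * cross m n q p)).
    by apply/funext => p; exact: FE.
  rewrite -(cftE _ q14 (cr q)) (cftZ _ _ q14); last exact: cross_rate.
  rewrite cross_inversion; congr (_ * _%:C); rewrite -mulrA; congr (_ * _).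
  rewrite /cross_kernel -(opprB (v / 2) q) fock_opp (addrC q).
  by rewrite mulrA.
transitivity (cintegral mu (fun q => cintegral mu (fun p => F (q, p)))).
  have [i1 _] := integrable_gauss2 q14 mF1 (fun z => norm_Re_le (FC z)).
  have [i2 _] := integrable_gauss2 q14 mF2 (fun z => norm_Im_le (FC z)).
  rewrite /fourier2 /cintegral; congr (_ +i* _).
    exact: (Rintegral_fubini i1 (fun q => gauss_rate_integrable q14 (crF q).1)).
  exact: (Rintegral_fubini i2 (fun q => gauss_rate_integrable q14 (crF q).2)).
rewrite (_ : (fun q => _) = (fun q => expi ((- u) * q) *
    ((pi * (-1) ^+ m) * cross_kernel m n (v / 2) q)%:C)); last first.
  by apply/funext => q; exact: inner.
rewrite -(ftE (fun q => (pi * (-1) ^+ m) * cross_kernel m n (v / 2) q)).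
rewrite (ftZ _ _ q14); last by apply: cross_kernel_rate; lra.
by rewrite /cross; congr (_ * ft _ _); field.
Qed.

End phase_space.

(** * Unordered sums and integrals *)

Section sums.
Variable R : realType.

Lemma pos_sub_neg (T : Type) (f : T -> R) x : f^\+ x - f^\- x = f x.
Proof. exact: (congr1 (fun g => g x) (funrposBneg f)). Qed.

Section family.
Variable I : choiceType.
Implicit Types a b f g : I -> R.
Local Notation esumR a := (\esum_(i in [set: I]) (a i)%:E)%E.

Definition rsummable a := (esumR (fun i => `|a i|) < +oo)%E.

Lemma rsummable_le a b : (forall i, `|a i| <= b i) -> (esumR b < +oo)%E -> rsummable a.
Proof. by move=> ab; apply: le_lt_trans; apply: le_esum => i _; rewrite lee_fin. Qed.

Lemma rsummable_fin a : (forall i, 0 <= a i) -> rsummable a -> esumR a \is a fin_num.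
Proof.
move=> a0 sa; rewrite ge0_fin_numE; last by apply: esum_ge0 => i _; rewrite lee_fin.
by apply: le_lt_trans sa; apply: le_esum => i _; rewrite lee_fin ler_norm.
Qed.

(** The value does not depend on the decomposition of the family into a
    difference of nonnegative summable ones; linearity of [rsum] follows. *)
Lemma rsum_sub f g : (forall i, 0 <= f i) -> (forall i, 0 <= g i) ->
  rsummable f -> rsummable g ->
  rsum (fun i => f i - g i) = fine (esumR f) - fine (esumR g).
Proof.
move=> f0 g0 sf sg.
have := @esumB R I setT (EFin \o f) (EFin \o g) sf sg
  (fun i _ => f0 i) (fun i _ => g0 i).
rewrite /rsum; set x := (X in X = _ -> _); set y := (X in _ = X -> _) => e.
transitivity (fine y); last by rewrite /y fineB//; exact: rsummable_fin.
rewrite -e /x; congr (fine (_ - _)).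
  by apply: eq_esum => i _; rewrite funeposE /funrpos EFin_max.
by apply: eq_esum => i _; rewrite funenegE /funrneg EFin_max.
Qed.

Lemma rsummable_pos a : rsummable a -> rsummable a^\+.
Proof.
apply: rsummable_le => i; rewrite ger0_norm ?funrpos_ge0// /funrpos.
by rewrite ge_max normr_ge0 ler_norm.
Qed.

Lemma rsummable_neg a : rsummable a -> rsummable a^\-.
Proof.
apply: rsummable_le => i; rewrite ger0_norm ?funrneg_ge0// /funrneg.
by rewrite ge_max normr_ge0 -normrN ler_norm.
Qed.

Lemma rsumE a : rsummable a -> rsum a = fine (esumR a^\+) - fine (esumR a^\-).
Proof.
move=> sa; rewrite /rsum fineB//; apply: rsummable_fin.
- by move=> i; exact: funrpos_ge0.
- exact: rsummable_pos.
- by move=> i; exact: funrneg_ge0.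
- exact: rsummable_neg.
Qed.

(** Both the positive and the negative part have a sum in [[0, M]]. *)
Lemma norm_rsum_le a b M : (forall i, `|a i| <= b i) -> (esumR b <= M%:E)%E ->
  `|rsum a| <= M.
Proof.
move=> ab bM; have sa : rsummable a.
  by apply: rsummable_le ab (le_lt_trans bM (ltry _)).
have h (c : I -> R) : (forall i, 0 <= c i) -> rsummable c ->
    (forall i, c i <= `|a i|) -> 0 <= fine (esumR c) <= M.
  move=> c0 sc cb; have cf := rsummable_fin c0 sc; apply/andP; split.
    by apply: fine_ge0; apply: esum_ge0 => i _; rewrite lee_fin.
  rewrite -lee_fin fineK//; apply: le_trans bM.
  by apply: le_esum => i _; rewrite lee_fin (le_trans (cb i)).
rewrite rsumE//.
have /andP[p0 p1] : 0 <= fine (esumR a^\+) <= M.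
  apply: h; [exact: funrpos_ge0|exact: rsummable_pos|move=> i].
  by rewrite ge_max normr_ge0 ler_norm.
have /andP[n0 n1] : 0 <= fine (esumR a^\-) <= M.
  apply: h; [exact: funrneg_ge0|exact: rsummable_neg|move=> i].
  by rewrite ge_max normr_ge0 -normrN ler_norm.
by rewrite ler_norml; apply/andP; split; lra.
Qed.

Lemma esumZ (c : R) a : 0 <= c -> (forall i, 0 <= a i) ->
  (esumR (fun i => c * a i)%R = c%:E * esumR a)%E.
Proof.
move=> c0 a0.
have le (d : R) b : 0 <= d -> (forall i, 0 <= b i) ->
    (esumR (fun i => d * b i)%R <= d%:E * esumR b)%E.
  move=> d0 b0; apply: ge_ereal_sup => _ [X [fX _] <-].
  under eq_fsbigr do rewrite EFinM.
  rewrite -ge0_mule_fsumr; last by move=> i; rewrite lee_fin.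
  by rewrite lee_wpmul2l ?lee_fin//; apply: esum_ge; exists X.
move: c0; rewrite le_eqVlt => /predU1P[<-|c0].
  by rewrite mul0e esum1// => i _; rewrite mul0r.
apply/eqP; rewrite eq_le le ?(ltW c0)//=.
rewrite -lee_pdivlMl//.
rewrite (_ : esumR a = esumR (fun i => c^-1 * (c * a i))); last first.
  by apply: eq_esum => i _; rewrite mulKf// gt_eqF.
by apply: le => [|i]; rewrite ?invr_ge0 ?mulr_ge0// ltW.
Qed.

Lemma rsumD a b : rsummable a -> rsummable b ->
  rsum (fun i => a i + b i) = rsum a + rsum b.
Proof.
move=> sa sb.
have pos0 (c : I -> R) i : 0 <= c^\+ i by exact: funrpos_ge0.
have neg0 (c : I -> R) i : 0 <= c^\- i by exact: funrneg_ge0.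
have D (c d : I -> R) : (forall i, 0 <= c i) -> (forall i, 0 <= d i) ->
    esumR (fun i => c i + d i) = (esumR c + esumR d)%E.
  by move=> c0 d0; rewrite -esumD// => i _; rewrite lee_fin.
have S (c d : I -> R) : (forall i, 0 <= c i) -> (forall i, 0 <= d i) ->
    rsummable c -> rsummable d -> rsummable (fun i => c i + d i).
  move=> c0 d0 sc sd; apply: (@rsummable_le _ (fun i => c i + d i)).
    by move=> i; rewrite ger0_norm// addr_ge0.
  by rewrite D// lte_add_pinfty// ltey_eq rsummable_fin.
have -> : (fun i => a i + b i) = (fun i => (a^\+ i + b^\+ i) - (a^\- i + b^\- i)).
  by apply/funext => i; rewrite opprD addrACA !pos_sub_neg.
have [pa na] := (rsummable_pos sa, rsummable_neg sa).
have [pb nb] := (rsummable_pos sb, rsummable_neg sb).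
rewrite rsum_sub; [|by move=> i; exact: addr_ge0..|exact: S|exact: S].
rewrite !D// !fineD; try exact: rsummable_fin.
by rewrite !rsumE//; lra.
Qed.

Lemma rsumN a : rsummable a -> rsum (fun i => - a i) = - rsum a.
Proof.
move=> sa; have sN : rsummable (fun i => - a i).
  by apply: rsummable_le sa => i; rewrite normrN.
apply/eqP; rewrite -addr_eq0 -rsumD//; apply/eqP.
under eq_fun do rewrite addNr.
rewrite (_ : (fun=> _) = (fun i : I => 0 - 0)); last by apply/funext => i; rewrite subrr.
have s0 : rsummable (fun _ : I => 0).
  by rewrite /rsummable esum1 ?ltry// => i _; rewrite normr0.
by rewrite rsum_sub// subrr.
Qed.

Lemma rsummableZ (c : R) a : rsummable a -> rsummable (fun i => c * a i).
Proof.
move=> sa; apply: (@rsummable_le _ (fun i => `|c| * `|a i|)).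
  by move=> i; rewrite normrM.
rewrite esumZ// -(fineK (x := esumR (fun i => `|a i|))) -?EFinM ?ltry//.
by rewrite ge0_fin_numE//; apply: esum_ge0 => i _; rewrite lee_fin.
Qed.

Lemma rsumZ (c : R) a : rsummable a -> rsum (fun i => c * a i) = c * rsum a.
Proof.
wlog c0 : c / 0 <= c => [H sa|sa].
  have [c0|/ltW c0] := leP 0 c; first exact: H.
  have := H (- c); rewrite oppr_ge0 => /(_ c0 sa) e.
  rewrite -[c]opprK mulNr -e -rsumN; last exact: rsummableZ.
  by congr rsum; apply/funext => i; rewrite mulNr.
rewrite [in RHS]rsumE// mulrBr.
have -> : (fun i => c * a i) = (fun i => c * a^\+ i - c * a^\- i).
  by apply/funext => i; rewrite -mulrBr pos_sub_neg.
have [pa na] := (rsummable_pos sa, rsummable_neg sa).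
have pos0 i : 0 <= a^\+ i by exact: funrpos_ge0.
have neg0 i : 0 <= a^\- i by exact: funrneg_ge0.
rewrite rsum_sub; [|by move=> i; exact: mulr_ge0..|exact: rsummableZ|exact: rsummableZ].
by rewrite !esumZ// !fineM//; exact: rsummable_fin.
Qed.

Definition csummable (a : I -> R[i]) :=
  rsummable (fun i => complex.Re (a i)) /\ rsummable (fun i => complex.Im (a i)).

Lemma csummable_le (x : I -> R[i]) b : (forall i, `|x i| <= (b i)%:C) ->
  (esumR b < +oo)%E -> csummable x.
Proof.
move=> xb sb; split; apply: rsummable_le sb => i.
  exact: norm_Re_le (xb i).
exact: norm_Im_le (xb i).
Qed.

Lemma csumZ (z : R[i]) (a : I -> R[i]) : csummable a ->
  csum (fun i => z * a i) = z * csum a.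
Proof.
move=> [s1 s2]; rewrite /csum; case: z => x y; apply: complex_ext => /=.
  rewrite -(rsumZ x s1) -(rsumZ y s2) -rsumN; last exact: rsummableZ.
  rewrite -rsumD; [|exact: rsummableZ|].
    by congr rsum; apply/funext => i; case: (a i).
  by apply: rsummable_le (rsummableZ y s2) => i; rewrite normrN.
rewrite -(rsumZ x s2) -(rsumZ y s1) -rsumD; [|exact: rsummableZ..].
by congr rsum; apply/funext => i; case: (a i).
Qed.

End family.

Section exchange.
Context d (T : measurableType d) (m : {measure set T -> \bar R}).
Local Notation N2 := (nat * nat)%type.

Lemma esum_nat2 (a : N2 -> \bar R) : (forall k, (0 <= a k)%E) ->
  (\esum_(k in [set: N2]) a k = \sum_(i <oo) \sum_(j <oo) a (i, j))%E.
Proof.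
move=> a0; rewrite nneseries_esumT; last by move=> i; exact: nneseries_ge0.
under [RHS]eq_esum do rewrite nneseries_esumT//.
rewrite esum_esum//; congr esum; last by apply/funext => -[].
by apply/seteqP; split.
Qed.

Lemma measurable_esum_nat2 (f : N2 -> T -> \bar R) :
  (forall k, measurable_fun setT (f k)) -> (forall k z, (0 <= f k z)%E) ->
  measurable_fun setT (fun z => \esum_(k in [set: N2]) f k z)%E.
Proof.
move=> mf f0; under eq_fun do rewrite esum_nat2//.
apply: ge0_emeasurable_sum => [i z _ _|i _]; first exact: nneseries_ge0.
by apply: ge0_emeasurable_sum.
Qed.

Lemma integral_esum_nat2 (f : N2 -> T -> \bar R) :
  (forall k, measurable_fun setT (f k)) -> (forall k z, (0 <= f k z)%E) ->
  (\int[m]_z (\esum_(k in [set: N2]) f k z) =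
   \esum_(k in [set: N2]) \int[m]_z f k z)%E.
Proof.
move=> mf f0; under eq_integral do rewrite esum_nat2//.
rewrite integral_nneseries//.
- rewrite esum_nat2; last by move=> k; exact: integral_ge0.
  by apply: eq_eseriesr => i _; rewrite integral_nneseries.
- by move=> i; apply: ge0_emeasurable_sum.
- by move=> i z _; exact: nneseries_ge0.
Qed.

(** Tonelli for the positive and for the negative parts separately. *)
Lemma Rintegral_rsum (b : N2 -> T -> R) :
  (forall k, measurable_fun setT (b k)) ->
  (forall z, rsummable (b^~ z)) ->
  (\esum_(k in [set: N2]) \int[m]_z `|(b k z)%:E| < +oo)%E ->
  \int[m]_z rsum (b^~ z) = rsum (fun k => \int[m]_z b k z).
Proof.
move=> mb sb sm.
have ib k : m.-integrable setT (EFin \o b k).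
  apply/integrableP; split; first exact/measurable_EFinP.
  apply: le_lt_trans sm; apply: esum_ge; exists [set k] => //.
  by rewrite fsbig_set1.
pose P z := (\esum_(k in [set: N2]) ((b^~ z)^\+ k)%:E)%E.
pose N z := (\esum_(k in [set: N2]) ((b^~ z)^\- k)%:E)%E.
have mpos k : measurable_fun setT (fun z => ((b k)^\+ z)%:E).
  by apply/measurable_EFinP; exact: measurable_funrpos.
have mneg k : measurable_fun setT (fun z => ((b k)^\- z)%:E).
  by apply/measurable_EFinP; exact: measurable_funrneg.
have pos0 k z : (0 <= ((b k)^\+ z)%:E)%E by rewrite lee_fin funrpos_ge0.
have neg0 k z : (0 <= ((b k)^\- z)%:E)%E by rewrite lee_fin funrneg_ge0.
have Pf z : P z \is a fin_num.
  apply: rsummable_fin; first by move=> i; exact: funrpos_ge0.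
  exact: rsummable_pos.
have Nf z : N z \is a fin_num.
  apply: rsummable_fin; first by move=> i; exact: funrneg_ge0.
  exact: rsummable_neg.
have P0 z : (0 <= P z)%E by apply: esum_ge0 => k _; exact: pos0.
have N0 z : (0 <= N z)%E by apply: esum_ge0 => k _; exact: neg0.
have IP : (\int[m]_z P z = \esum_(k in [set: N2]) \int[m]_z ((b k)^\+ z)%:E)%E.
  exact: (@integral_esum_nat2 (fun k z => ((b k)^\+ z)%:E)).
have IN : (\int[m]_z N z = \esum_(k in [set: N2]) \int[m]_z ((b k)^\- z)%:E)%E.
  exact: (@integral_esum_nat2 (fun k z => ((b k)^\- z)%:E)).
pose p k := \int[m]_z (b k)^\+ z.
pose n k := \int[m]_z (b k)^\- z.
have ip k : m.-integrable setT (EFin \o (b k)^\+) by exact: integrable_funrpos.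
have im k : m.-integrable setT (EFin \o (b k)^\-) by exact: integrable_funrneg.
have pE k : (\int[m]_z ((b k)^\+ z)%:E = (p k)%:E)%E.
  by rewrite /p /Rintegral fineK//; exact: (integrable_fin_num _ (ip k)).
have nE k : (\int[m]_z ((b k)^\- z)%:E = (n k)%:E)%E.
  by rewrite /n /Rintegral fineK//; exact: (integrable_fin_num _ (im k)).
have p0 k : 0 <= p k by apply: Rintegral_ge0 => z _; exact: funrpos_ge0.
have n0 k : 0 <= n k by apply: Rintegral_ge0 => z _; exact: funrneg_ge0.
have sp : rsummable p.
  rewrite /rsummable; apply: le_lt_trans sm; apply: le_esum => k _.
  rewrite ger0_norm// -pE; apply: ge0_le_integral => //.
  - by apply: measurableT_comp => //; exact/measurable_EFinP.
  - by move=> z _; rewrite lee_fin ge_max normr_ge0 ler_norm.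
have sn : rsummable n.
  rewrite /rsummable; apply: le_lt_trans sm; apply: le_esum => k _.
  rewrite ger0_norm// -nE; apply: ge0_le_integral => //.
  - by apply: measurableT_comp => //; exact/measurable_EFinP.
  - by move=> z _; rewrite lee_fin ge_max normr_ge0 -normrN ler_norm.
have PI : m.-integrable setT P.
  apply/integrableP; split.
    exact: (@measurable_esum_nat2 (fun k z => ((b k)^\+ z)%:E)).
  under eq_integral do rewrite gee0_abs//.
  rewrite IP; under eq_esum do rewrite pE.
  by rewrite ltey_eq rsummable_fin.
have NI : m.-integrable setT N.
  apply/integrableP; split.
    exact: (@measurable_esum_nat2 (fun k z => ((b k)^\- z)%:E)).
  under eq_integral do rewrite gee0_abs//.
  rewrite IN; under eq_esum do rewrite nE.
  by rewrite ltey_eq rsummable_fin.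
have -> : (fun k => \int[m]_z b k z) = (fun k => p k - n k).
  apply/funext => k; rewrite /p /n -RintegralB//.
  by apply: eq_Rintegral => z _; rewrite pos_sub_neg.
rewrite (rsum_sub p0 n0 sp sn).
have -> : (\esum_(k in [set: N2]) (p k)%:E = \int[m]_z P z)%E.
  by rewrite IP; apply: eq_esum => k _; rewrite pE.
have -> : (\esum_(k in [set: N2]) (n k)%:E = \int[m]_z N z)%E.
  by rewrite IN; apply: eq_esum => k _; rewrite nE.
rewrite -fineB; try exact: integrable_fin_num.
rewrite -integralB//; congr fine; apply: eq_integral => z _.
by rewrite /rsum fineK// fin_numB Pf Nf.
Qed.

Lemma cintegral_csum (b : N2 -> T -> R[i]) :
  (forall k, cmeasurable (b k)) -> (forall z, csummable (b^~ z)) ->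
  (\esum_(k in [set: N2]) \int[m]_z `|(complex.Re (b k z))%:E| < +oo)%E ->
  (\esum_(k in [set: N2]) \int[m]_z `|(complex.Im (b k z))%:E| < +oo)%E ->
  cintegral m (fun z => csum (b^~ z)) = csum (fun k => cintegral m (b k)).
Proof.
move=> mb sb s1 s2; rewrite /cintegral /csum /=; congr (_ +i* _).
  apply: (@Rintegral_rsum (fun k z => complex.Re (b k z))) => //.
  - by move=> k; exact: (mb k).1.
  - by move=> z; exact: (sb z).1.
apply: (@Rintegral_rsum (fun k z => complex.Im (b k z))) => //.
- by move=> k; exact: (mb k).2.
- by move=> z; exact: (sb z).2.
Qed.

End exchange.

End sums.

(** * Weighted sums of the decay bound *)

Section decay_sums.
Variable R : realType.
Implicit Types (r s B b z : R).

(** [expR y >= y^p / p!] with [p] so large that [s p >= M]. *)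
Lemma poly_decay (s d : R) (M : nat) : 0 < s -> 0 < d ->
  exists2 C, 0 <= C & forall k : nat,
    k.+1%:R ^+ M * expR (- d * (k%:R `^ s)) <= C.
Proof.
move=> s0 d0; pose p := Num.bound (M%:R / s).
have Ms : M%:R <= s * p.+1%:R.
  have := archi_boundP (divr_ge0 (ler0n R M) (ltW s0)); rewrite ltr_pdivrMr// mulrC.
  move=> /ltW/le_trans; apply; rewrite ler_wpM2l ?(ltW s0)// ler_nat//.
pose c := 2 ^+ M * p.+1`!%:R / d ^+ p.+1.
have c0 : 0 <= c by rewrite divr_ge0 ?exprn_ge0 ?mulr_ge0 ?ltW.
exists (1 + c); first by rewrite addr_ge0.
case=> [|k].
  rewrite expr1n mul1r (@le_trans _ _ 1) ?lerDl// -[leRHS]expR0 ler_expR.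
  by rewrite mulNr oppr_le0 mulr_ge0 ?powR_ge0 ?ltW.
set x := k.+1%:R : R; have x1 : 1 <= x by rewrite ler1n.
have x0 : 0 <= x by apply: le_trans x1.
rewrite mulNr expRN ler_pdivrMr ?expR_gt0//.
have h1 : k.+2%:R ^+ M <= 2 ^+ M * x ^+ M.
  rewrite -exprMn lerXn2r ?nnegrE ?mulr_ge0// -(natr1 k.+1) -/x; lra.
apply: (le_trans h1).
have h2 : d ^+ p.+1 * x ^+ M / p.+1`!%:R <= expR (d * x `^ s).
  have dx : 0 <= d * x `^ s by rewrite mulr_ge0 ?powR_ge0 ?ltW.
  apply: le_trans (expR_ge1Dxn p dx); apply: ler_wpDl => //.
  rewrite ler_wpM2r ?invr_ge0// exprMn ler_wpM2l ?exprn_ge0 ?(ltW d0)//.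
  by rewrite -!powR_mulrn ?powR_ge0// -powRrM ler_powR.
apply: (@le_trans _ _ (c * (d ^+ p.+1 * x ^+ M / p.+1`!%:R))); last first.
  rewrite mulrDl mul1r; apply: ler_wpDl; first exact: expR_ge0.
  by rewrite ler_wpM2l.
rewrite le_eqVlt; apply/orP; left; apply/eqP; rewrite /c; field.
by rewrite pnatr_eq0 -lt0n fact_gt0 /= expf_neq0// gt_eqF.
Qed.

Lemma nneseries_inv_sqr : (\sum_(i <oo) ((i.+1%:R ^+ 2)^-1 : R)%:E <= 2%:E)%E.
Proof.
apply: lime_le.
  by apply: is_cvg_nneseries => n _ _; rewrite lee_fin invr_ge0 exprn_ge0.
apply: nearW => n; rewrite sumEFin lee_fin.
suff H k : \sum_(0 <= i < k.+1) ((i.+1%:R ^+ 2)^-1 : R) <= 2 - k.+1%:R^-1.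
  case: n => [|n]; first by rewrite big_nil.
  by apply: le_trans (H n) _; rewrite lerBlDr lerDl invr_ge0.
elim: k => [|k IH]; first by rewrite big_nat1 expr1n invr1; lra.
rewrite big_nat_recr//=; apply: (le_trans (lerD IH (lexx _))).
have e : k.+2%:R = k.+1%:R + 1 :> R by rewrite natr1.
have : 1 <= k.+1%:R :> R by rewrite ler1n.
rewrite e; move: (k.+1%:R) => x x1.
rewrite -subr_ge0.
have -> : 2 - (x + 1)^-1 - (2 - x^-1 + ((x + 1) ^+ 2)^-1) = (x * (x + 1) ^+ 2)^-1.
  by field; rewrite !gt_eqF//; lra.
by rewrite invr_ge0 mulr_ge0// ?exprn_ge0; lra.
Qed.

(** By [poly_decay], a term is [O ((m + n + 1)^-4)], hence
    [O ((m + 1)^-2 (n + 1)^-2)]. *)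
Lemma decay_sum (s d : R) (N : nat) : 0 < s -> 0 < d ->
  exists2 K : R, 0 <= K & (\esum_(k in [set: nat * nat])
    ((k.1 + k.2).+1%:R ^+ N * expR (- d * ((k.1 + k.2)%:R `^ s)))%:E <= K%:E)%E.
Proof.
move=> s0 d0; have [C C0 HC] := poly_decay (N + 4) s0 d0.
exists (C * 4); first by rewrite mulr_ge0.
pose u (i : nat) : R := (i.+1%:R ^+ 2)^-1.
have u0 i : 0 <= u i by rewrite invr_ge0 exprn_ge0.
apply: (@le_trans _ _ (\esum_(k in [set: nat * nat]) (C * (u k.1 * u k.2))%:E)%E).
  apply: le_esum => -[m n] _ /=; rewrite lee_fin.
  set t : R := (m + n).+1%:R; have t0 : 0 < t by rewrite ltr0n.
  have h := HC (m + n)%N; rewrite exprD -/t in h.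
  have hu : (t ^+ 4)^-1 <= u m * u n.
    rewrite /u -invfM -exprMn lef_pV2 ?posrE ?exprn_gt0 ?mulr_gt0 ?ltr0n//.
    rewrite (_ : t ^+ 4 = (t ^+ 2) ^+ 2); last by rewrite -exprM.
    rewrite lerXn2r ?nnegrE ?exprn_ge0 ?mulr_ge0 ?(ltW t0)// -natrM -natrX ler_nat.
    by rewrite expnS expn1 leq_mul// ltnS ?leq_addr ?leq_addl.
  apply: (@le_trans _ _ (C * (t ^+ 4)^-1)); last by rewrite ler_wpM2l.
  by rewrite ler_pdivlMr ?exprn_gt0// mulrAC.
rewrite esum_nat2; last by move=> k; rewrite lee_fin mulr_ge0// mulr_ge0.
apply: (@le_trans _ _ (\sum_(i <oo) (C * 2 * u i)%:E)%E).
  apply: lee_nneseries => [i _ _|i _].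
    by apply: nneseries_ge0 => j *; rewrite lee_fin mulr_ge0// mulr_ge0.
  rewrite (eq_eseriesr (g := fun j => ((C * u i)%:E * (u j)%:E)%E)); last first.
    by move=> j _; rewrite -EFinM mulrA.
  rewrite nneseriesZl; last by move=> j _; rewrite lee_fin.
  rewrite (_ : C * 2 * u i = C * u i * 2) 1?(EFinM (C * u i)); last by ring.
  apply: lee_wpmul2l; rewrite ?lee_fin ?mulr_ge0//; exact: nneseries_inv_sqr.
rewrite (eq_eseriesr (g := fun j => ((C * 2)%:E * (u j)%:E)%E)); last by [].
rewrite nneseriesZl; last by move=> j _; rewrite lee_fin.
rewrite (_ : C * 4 = C * 2 * 2); last by ring.
rewrite (EFinM (C * 2)); apply: lee_wpmul2l; rewrite ?lee_fin ?mulr_ge0//.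
exact: nneseries_inv_sqr.
Qed.

Lemma powR_large (s L z : R) : 0 < s -> 0 <= L -> L `^ s^-1 <= z -> L <= z `^ s.
Proof.
move=> s0 L0 Lz; have sn : s != 0 by rewrite gt_eqF.
rewrite -[leLHS](powRr1 L0) -(mulVf sn) powRrM.
by rewrite ge0_ler_powR ?nnegrE ?powR_ge0 ?(ltW s0)// (le_trans _ Lz)// powR_ge0.
Qed.

(** The split at [k.1 + k.2 = (1 - t) z^2].  Write [B = b + 4d] with [b >= beta].  Below
    the threshold, [a = t/2] makes the exponent at most [2 - a^2 z^2].  Above it,
    [a = 0] is used, and [t] is such that [(B - d) (1 - t) = b + d]; the remaining
    [expR (- d (k.1 + k.2)^(r/2))] ensures summability.  In both cases the gain over
    [expR (- b z^r)] is a factor [expR (- d z^r)], which absorbs all constants. *)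
Lemma weighted_sum_decay (r B beta e : R) : 0 < r -> r < 2 -> 0 < B -> beta < B -> 0 < e ->
  exists2 z0 : R, 0 <= z0 & forall z, z0 <= z -> forall x : nat * nat -> R,
  (forall k (a : R), 0 <= a -> a < 1 -> x k <= decay B r k.1 k.2 *
    ((2 * k.1%:R + 2) * (2 * k.2%:R + 2) *
     expR (a * (k.1%:R + k.2%:R + 2) / (1 - a ^+ 2) - a * z ^+ 2))) ->
  (\esum_(k in [set: nat * nat]) (x k)%:E <= (e * expR (- beta * z `^ r))%:E)%E.
Proof.
move=> r0 r2 B0 bB e0.
(* [beta] may be nonpositive; the argument needs a positive rate *)
pose b := Num.max beta (B / 2).
have b0 : 0 < b by rewrite lt_max divr_gt0// orbT.
have bb : beta <= b by rewrite le_max lexx.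
have bB' : b < B by rewrite gt_max bB; lra.
pose d := (B - b) / 4; have d0 : 0 < d by rewrite divr_gt0// subr_gt0.
have Bd : B = b + 4 * d by rewrite /d; field.
pose t := 2 * d / (b + 3 * d).
have bd : 0 < b + 3 * d by lra.
have t0 : 0 < t by rewrite divr_gt0// mulr_gt0.
have t1 : t < 1 by rewrite ltr_pdivrMr//; lra.
have bt : (b + 3 * d) * (1 - t) = b + d by rewrite /t; field; rewrite gt_eqF.
pose a := t / 2; have a0 : 0 < a by rewrite divr_gt0.
have a1 : a < 1 / 2 by rewrite /a; lra.
have s0 : 0 < r / 2 by rewrite divr_gt0.
have [K K0 HK] := @decay_sum (r / 2) d 2 s0 d0.
pose C := 4 * K * (expR 2 + 1).
have C0 : 0 <= C by rewrite mulr_ge0 ?addr_ge0 ?expR_ge0// mulr_ge0.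
pose L1 := (b + d) / a ^+ 2; pose L2 := C / (e * d).
have L10 : 0 <= L1 by rewrite divr_ge0 ?sqr_ge0//; lra.
have L20 : 0 <= L2 by apply: divr_ge0 => //; apply: mulr_ge0; exact: ltW.
have r20 : 0 < 2 - r by rewrite subr_gt0.
exists (Num.max (L1 `^ (2 - r)^-1) (L2 `^ r^-1)); first by rewrite le_max powR_ge0.
move=> z; rewrite ge_max => /andP[z1 z2] x Hx.
have z0 : 0 <= z by apply: le_trans z1; exact: powR_ge0.
have zL1 := powR_large r20 L10 z1; have zL2 := powR_large r0 L20 z2.
pose Z := z `^ r; have Z0 : 0 <= Z by exact: powR_ge0.
have zz : (b + d) * Z <= a ^+ 2 * z ^+ 2.
  have -> : z ^+ 2 = z `^ (2 - r) * Z.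
    rewrite /Z; have [->|zn0] := eqVneq z 0.
      by rewrite powR0 ?gt_eqF// mul0r expr0n.
    by rewrite -powRD ?zn0 ?implybT// subrK powR_mulrn.
  rewrite mulrA ler_wpM2r// mulrC -ler_pdivrMr ?exprn_gt0//.
pose G := (expR 2 + 1) * expR (- (b + d) * Z).
have xG k : x k <= 4 * G *
    ((k.1 + k.2).+1%:R ^+ 2 * expR (- d * ((k.1 + k.2)%:R `^ (r / 2)))).
  case: k => m n; have := Hx (m, n); rewrite /= /decay.
  set T := _ `^ (r / 2) => {}Hx.
  have T0 : 0 <= T by exact: powR_ge0.
  have pol : (2 * m%:R + 2) * (2 * n%:R + 2) <= 4 * (m + n).+1%:R ^+ 2 :> R.
    rewrite -(natr1 (m + n)) natrD; have := ler0n R m; have := ler0n R n.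
    by move: (m%:R) (n%:R) => u v; nra.
  have pol0 : 0 <= (2 * m%:R + 2) * (2 * n%:R + 2) :> R.
    by rewrite mulr_ge0 ?addr_ge0 ?mulr_ge0.
  have eB : expR (- B * T) = expR (- d * T) * expR (- (b + 3 * d) * T).
    by rewrite -expRD Bd; congr expR; ring.
  suff [y [y0 y1 yG]] : exists y, [/\ 0 <= y, x (m, n) <= expR (- B * T) *
      ((2 * m%:R + 2) * (2 * n%:R + 2) * y) & expR (- (b + 3 * d) * T) * y <= G].
    apply: (le_trans y1); rewrite eB.
    have -> : expR (- d * T) * expR (- (b + 3 * d) * T) *
        ((2 * m%:R + 2) * (2 * n%:R + 2) * y) =
      (expR (- (b + 3 * d) * T) * y) *
        ((2 * m%:R + 2) * (2 * n%:R + 2) * expR (- d * T)) by ring.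
    have -> : 4 * G * ((m + n).+1%:R ^+ 2 * expR (- d * T)) =
      G * (4 * (m + n).+1%:R ^+ 2 * expR (- d * T)) by ring.
    apply: ler_pM; [| |exact: yG|].
    - by apply: mulr_ge0 => //; exact: expR_ge0.
    - by apply: mulr_ge0; [exact: pol0|exact: expR_ge0].
    - by rewrite ler_wpM2r ?expR_ge0.
  have [h|h] := leP ((m + n)%:R) ((1 - t) * z ^+ 2).
    exists (expR (a * (m%:R + n%:R + 2) / (1 - a ^+ 2) - a * z ^+ 2)).
    split; [exact: expR_ge0|by apply: Hx; [exact: ltW|lra]|].
    apply: (@le_trans _ _ (expR (2 - a ^+ 2 * z ^+ 2))).
      rewrite -[leRHS]mul1r.
      apply: ler_pM; rewrite ?expR_ge0//.
        by rewrite -[leRHS]expR0 ler_expR mulNr oppr_le0 mulr_ge0// ltW.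
      rewrite ler_expR lerBlDr ler_pdivrMr; last by nra.
      move: h; rewrite natrD /t (_ : 2 * d / _ = 2 * a); last first.
        by rewrite /a /t; field; rewrite gt_eqF.
      have w0 := sqr_ge0 z; move: (z ^+ 2) w0 (m%:R + n%:R) => w w0 tau h.
      have h1 : 0 <= a * ((1 - 2 * a) * w - tau) by rewrite mulr_ge0 ?subr_ge0// ltW.
      have h2 : 0 <= a ^+ 2 * w * (1 - a + a ^+ 2).
        apply: mulr_ge0; first by apply: mulr_ge0 => //; exact: sqr_ge0.
        by have := sqr_ge0 a; lra.
      rewrite -subr_ge0.
      have -> : (2 - a ^+ 2 * w + a * w) * (1 - a ^+ 2) - a * (tau + 2) =
        a * ((1 - 2 * a) * w - tau) + a ^+ 2 * w * (1 - a + a ^+ 2) +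
        2 * (1 - a ^+ 2 - a) by ring.
      have : a ^+ 2 <= 1 / 4 by nra.
      by lra.
    rewrite expRD /G mulrDl mul1r; apply: ler_wpDr; first exact: expR_ge0.
    by rewrite ler_wpM2l ?expR_ge0// ler_expR mulNr lerN2.
  exists 1; split => //.
    have := Hx 0 (lexx _) ltr01.
    by rewrite !mul0r subr0 expR0.
  rewrite mulr1; apply: (@le_trans _ _ (expR (- (b + d) * Z))).
    rewrite ler_expR !mulNr lerN2 -bt -mulrA ler_wpM2l ?(ltW bd)//.
    have t10 : 0 < 1 - t by rewrite subr_gt0.
    apply: (@le_trans _ _ (((1 - t) * z ^+ 2) `^ (r / 2))); last first.
      by rewrite ge0_ler_powR ?nnegrE ?(ltW s0) ?(ltW h)// mulr_ge0 ?sqr_ge0// ltW.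
    rewrite powRM ?sqr_ge0 ?(ltW t10)// -[z ^+ 2]powR_mulrn// -powRrM.
    rewrite (_ : 2%:R * (r / 2) = r); last by field.
    by rewrite ler_wpM2r// ger1_powR ?t10/= ?gerBl ?(ltW t0)//; lra.
  by rewrite /G ler_peMl ?expR_ge0// lerDr expR_ge0.
apply: (@le_trans _ _ (4 * G * K)%:E).
  apply: (@le_trans _ _ (\esum_(k in [set: nat * nat]) (4 * G *
    ((k.1 + k.2).+1%:R ^+ 2 * expR (- d * ((k.1 + k.2)%:R `^ (r / 2)))))%:E)%E).
    by apply: le_esum => k _; rewrite lee_fin.
  have G0 : 0 <= 4 * G by rewrite !mulr_ge0 ?addr_ge0 ?expR_ge0.
  rewrite esumZ; [|exact: G0|by move=> k; rewrite mulr_ge0 ?expR_ge0 ?exprn_ge0].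
  by rewrite (EFinM (4 * G)); apply: lee_wpmul2l; rewrite ?lee_fin.
rewrite lee_fin.
apply: (@le_trans _ _ (e * expR (- b * Z))); last first.
  by rewrite ler_wpM2l ?(ltW e0)// ler_expR !mulNr lerN2 ler_wpM2r.
have -> : 4 * G * K = C * expR (- d * Z) * expR (- b * Z).
  rewrite -[RHS]mulrA -expRD /C /G.
  have -> : - d * Z + - b * Z = - (b + d) * Z by ring.
  by ring.
rewrite ler_wpM2r ?expR_ge0// mulNr expRN ler_pdivrMr ?expR_gt0//.
apply: (@le_trans _ _ (e * (1 + d * Z))); last first.
  by rewrite ler_wpM2l ?(ltW e0)// expR_ge1Dx.
have : L2 <= Z by [].
have ed : 0 < e * d by exact: mulr_gt0.
rewrite /L2 ler_pdivrMr// => h; rewrite mulrDr mulr1; have := e0; lra.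
Qed.

End decay_sums.

(** * Estimates of the Wigner function and of its Fourier transform *)

Section density.
Variable R : realType.
Local Notation mu := (@lebesgue_measure R).

Lemma RintegralN d (T : measurableType d) (m : {measure set T -> \bar R}) (f : T -> R) :
  \int[m]_x (- f x) = - \int[m]_x f x.
Proof.
rewrite /Rintegral [in LHS]integralE [in RHS]integralE.
rewrite (_ : (fun x => (- f x)%:E)^\+%E = (EFin \o f)^\-%E); last first.
  by apply/funext => x; rewrite funeposE funenegE.
rewrite (_ : (fun x => (- f x)%:E)^\-%E = (EFin \o f)^\+%E); last first.
  by apply/funext => x; rewrite funeposE funenegE /= opprK.
have a0 : (0 <= \int[m]_x (EFin \o f)^\+%E x)%E by apply: integral_ge0.
have b0 : (0 <= \int[m]_x (EFin \o f)^\-%E x)%E by apply: integral_ge0.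
move: a0 b0; move: (\int[m]_x (EFin \o f)^\+%E x)%E (\int[m]_x (EFin \o f)^\-%E x)%E.
by case=> [s||] [t||] //= _ _; rewrite ?oppr0// opprB.
Qed.

Lemma inner_conj (f g : R -> R[i]) : inner g f = (inner f g)^*.
Proof.
rewrite /inner /cintegral; apply: complex_ext => /=.
  by apply: eq_Rintegral => x _; case: (f x) (g x) => [a b] [c d] /=; ring.
rewrite -RintegralN.
by apply: eq_Rintegral => x _; case: (f x) (g x) => [a b] [c d] /=; ring.
Qed.

Lemma L2_cfock n : L2 (@cfock R n).
Proof.
have c : gauss_rate (1 / 4) (@fock R n) by apply: fock_gauss_rate; lra.
split.
- exact: gauss_rate_measurable c.
- exact: measurable_cst.
- have i : mu.-integrable setT (EFin \o (fun x => fock n x ^+ 2)).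
    apply: (@gauss_rate_integrable _ (1/4 + 1/4)) => //; under eq_fun do rewrite expr2.
    exact: gauss_rateM.
  have E x : Normc.normc (cfock n x) ^+ 2 = fock n x ^+ 2.
    by rewrite /= expr0n addr0 sqrtr_sqr real_normK ?num_real.
  under eq_integral do rewrite E.
  by have /fin_numPlt/andP[] := integrable_fin_num measurableT i.
Qed.

(** Selfadjointness makes the density matrix hermitian, which gives the bound above
    the diagonal. *)
Lemma density_matrix_norm (rho : (R -> R[i]) -> R -> R[i]) (D : nat -> nat -> R) :
  quantum_state rho -> (forall m n, D m n = D n m) ->
  (forall m n : nat, (n <= m)%N -> `|density_matrix rho m n| <= (D m n)%:C) ->
  forall m n, `|density_matrix rho m n| <= (D m n)%:C.
Proof.
move=> q DC h m n; have [nm|/ltnW mn] := leqP n m; first exact: h.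
rewrite /density_matrix (qs_selfadjoint q (L2_cfock m) (L2_cfock n)) inner_conj normcJ DC.
exact: h.
Qed.

End density.

Section main.
Variable R : realType.
Local Notation mu := (@lebesgue_measure R).
Local Notation mu2 := (mu \x mu)%E.
Local Notation N2 := (nat * nat)%type.
Variables (r B : R).
Hypotheses (r0 : 0 < r) (B0 : 0 < B).

Let s0 : 0 < r / 2. Proof. by apply: divr_gt0. Qed.

Lemma decay_ge0 m n : 0 <= decay B r m n. Proof. exact: expR_ge0. Qed.

Lemma decay_poly_sum (N : nat) (C : R) : 0 <= C -> (\esum_(k in [set: N2])
  (C * ((k.1 + k.2).+1%:R ^+ N * decay B r k.1 k.2))%:E < +oo)%E.
Proof.
move=> C0; have [K K0 HK] := decay_sum N s0 B0.
rewrite esumZ//; last by move=> k; rewrite mulr_ge0 ?exprn_ge0 ?expR_ge0.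
apply: (@le_lt_trans _ _ (C%:E * K%:E)%E); last by rewrite -EFinM ltry.
by apply: lee_wpmul2l; rewrite ?lee_fin.
Qed.

(** The term [m = n = 0] of the sum is [1]. *)
Lemma decay_amplitude_ge z : 0 <= z -> r < 2 -> pi^-1 <= decay_amplitude r B z.
Proof.
move=> z0 r2; rewrite /decay_amplitude -[leLHS]mulr1 ler_wpM2l ?invr_ge0 ?pi_ge0//.
apply: (@le_trans _ _ (rsum (fun k : N2 => decay B r k.1 k.2))); last first.
  rewrite lerDl mulr_ge0 ?powR_ge0// divr_ge0// mulr_ge0// ltW//.
have sD : (\esum_(k in [set: N2]) (decay B r k.1 k.2)%:E < +oo)%E.
  have := decay_poly_sum 0 (ler01 : 0 <= 1 :> R).
  by under eq_esum do rewrite expr0 !mul1r.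
rewrite /rsum (_ : (\esum_(i in _) (_^\- i)%:E)%E = 0%E); last first.
  apply: esum1 => k _; rewrite /funrneg; congr EFin; apply/max_idPr.
  by rewrite oppr_le0 decay_ge0.
rewrite sube0 (eq_esum (b := fun k : N2 => (decay B r k.1 k.2)%:E)); last first.
  by move=> k _; rewrite /funrpos; congr EFin; apply/max_idPl; exact: decay_ge0.
rewrite -lee_fin fineK; last first.
  by rewrite ge0_fin_numE//; apply: esum_ge0 => k _; rewrite lee_fin decay_ge0.
apply: esum_ge; exists [set (0%N, 0%N)] => //.
by rewrite fsbig_set1 /= /decay powR0 ?gt_eqF// mulr0 expR0.
Qed.

(* the coefficients [c] stand for the entries of the density matrix *)
Variable c : N2 -> R[i].
Hypothesis cD : forall k, `|c k| <= (decay B r k.1 k.2)%:C.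

Let pol (k : N2) : R := (2 * k.1%:R + 2) * (2 * k.2%:R + 2).

Let pol0 k : 0 <= pol k.
Proof. by rewrite mulr_ge0 ?addr_ge0 ?mulr_ge0. Qed.

Let pol_le k : pol k <= 4 * (k.1 + k.2).+1%:R ^+ 2.
Proof.
rewrite /pol -(natr1 (k.1 + k.2)) natrD; have := ler0n R k.1; have := ler0n R k.2.
by move: (k.1%:R) (k.2%:R) => u v; nra.
Qed.

Lemma norm_coef_cross k (w : R[i]) (q p a : R) : 0 <= a -> a < 1 -> `|w| <= 1 ->
  `|w * c k * cross k.1 k.2 q p| <= (decay B r k.1 k.2 * (pol k *
     expR (a * (k.1%:R + k.2%:R + 2) / (1 - a ^+ 2) - a * (q ^+ 2 + p ^+ 2))))%:C.
Proof.
move=> a0 a1 w1; rewrite !normrM rmorphM /=; apply: ler_pM => //.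
- by rewrite -[leRHS]mul1r; apply: ler_pM.
- exact: cross_bound.
Qed.

Lemma csum_cross_le (w : N2 -> R[i]) (q p z M : R) :
  (forall k, `|w k| <= 1) -> q ^+ 2 + p ^+ 2 = z ^+ 2 ->
  (forall x : N2 -> R,
    (forall k (a : R), 0 <= a -> a < 1 -> x k <= decay B r k.1 k.2 * (pol k *
     expR (a * (k.1%:R + k.2%:R + 2) / (1 - a ^+ 2) - a * z ^+ 2))) ->
    (\esum_(k in [set: N2]) (x k)%:E <= M%:E)%E) ->
  `|csum (fun k => w k * c k * cross k.1 k.2 q p)| <= (M + M)%:C.
Proof.
move=> w1 qp H.
pose x k := complex.Re `|w k * c k * cross k.1 k.2 q p|.
have xE k : `|w k * c k * cross k.1 k.2 q p| = (x k)%:C by rewrite /x normc_def.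
have xM : (\esum_(k in [set: N2]) (x k)%:E <= M%:E)%E.
  apply: H => k a a0 a1; rewrite -lecR -xE -qp; exact: norm_coef_cross.
apply: norm_le_Re_Im; apply: norm_rsum_le xM => k.
  by apply: norm_Re_le; rewrite xE.
by apply: norm_Im_le; rewrite xE.
Qed.

Let piV1 : `|(pi^-1)%:C : R[i]| <= 1.
Proof.
rewrite normc_def /= expr0n addr0 sqrtr_sqr ger0_norm ?invr_ge0 ?pi_ge0//.
by rewrite lecR invf_le1 ?pi_gt0// (le_trans _ (pi_ge2 R))// ler1n.
Qed.

Lemma cintegralZ (z : R[i]) (F : R * R -> R[i]) :
  mu2.-integrable setT (EFin \o (fun x => complex.Re (F x))) ->
  mu2.-integrable setT (EFin \o (fun x => complex.Im (F x))) ->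
  cintegral mu2 (fun x => z * F x) = z * cintegral mu2 F.
Proof.
move=> i1 i2; have I (u : R) f : mu2.-integrable setT (EFin \o f) ->
    mu2.-integrable setT (EFin \o (fun x => u * f x)).
  by move=> i; exact: (integrableZl measurableT u i).
rewrite /cintegral; case: z => u v; apply: complex_ext => /=.
  rewrite -!RintegralZl// -RintegralB//; try exact: I.
  by apply: eq_Rintegral => x _; case: (F x).
rewrite -!RintegralZl// -RintegralD//; try exact: I.
by apply: eq_Rintegral => x _; case: (F x).
Qed.

(** Term by term integration.  The value at [(u, v)] is a series like that of the
    Wigner function itself, at the point [(v/2, - u/2)]. *)
Lemma fourier2_csum (u v : R) :
  fourier2 (fun q p => csum (fun k : N2 => c k * wigner_coef k.1 k.2 q p)) u v =
  csum (fun k => ((-1) ^+ k.1)%:C * c k * cross k.1 k.2 (v / 2) (- u / 2)).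
Proof.
pose e (z : R * R) : R[i] := expi (- (u * z.1 + v * z.2)).
pose b (k : N2) (z : R * R) := e z * ((pi^-1)%:C * c k * cross k.1 k.2 z.1 z.2).
have bn k (a : R) z : 0 <= a -> a < 1 -> `|b k z| <= (decay B r k.1 k.2 * (pol k *
     expR (a * (k.1%:R + k.2%:R + 2) / (1 - a ^+ 2) - a * (z.1 ^+ 2 + z.2 ^+ 2))))%:C.
  by move=> a0 a1; rewrite normrM norm_expi mul1r; exact: norm_coef_cross.
have poly k : decay B r k.1 k.2 * pol k <=
    4 * ((k.1 + k.2).+1%:R ^+ 2 * decay B r k.1 k.2).
  by rewrite mulrC mulrA ler_wpM2r ?decay_ge0.
have P4 := decay_poly_sum 2 (ler0n R 4).
have cs z : csummable (fun k => (pi^-1)%:C * c k * cross k.1 k.2 z.1 z.2).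
  apply: csummable_le P4 => k.
  apply: (le_trans (norm_coef_cross k z.1 z.2 (lexx 0) ltr01 piV1)).
  by rewrite lecR !mul0r subr0 expR0 mulr1.
have csb z : csummable (b^~ z).
  apply: csummable_le P4 => k; apply: (le_trans (bn k 0 z (lexx 0) ltr01)).
  by rewrite lecR !mul0r subr0 expR0 mulr1.
have mb k : cmeasurable (b k).
  apply: cmeasurableM; first exact: cmeasurable_character.
  by apply: cmeasurableM; [exact: cmeasurable_cst|exact: cmeasurable_cross].
(* this rate costs a bounded factor, and the Gaussian has integral [pi / a k] *)
pose a (k : N2) : R := (k.1%:R + k.2%:R + 2)^-1.
have a0 k : 0 < a k by rewrite invr_gt0 ltr_wpDl ?addr_ge0.
have a1 k : a k <= 1 / 2.
  by rewrite /a mul1r lef_pV2 ?posrE ?ltr_wpDl ?addr_ge0// lerDr addr_ge0.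
pose A (k : N2) : R := decay B r k.1 k.2 * (pol k * expR 2).
have A0 k : 0 <= A k by rewrite mulr_ge0 ?decay_ge0// mulr_ge0 ?expR_ge0.
have bA k z : `|b k z| <= (A k * expR (- a k * (z.1 ^+ 2 + z.2 ^+ 2)))%:C.
  have ak1 : a k < 1 by apply: le_lt_trans (a1 k) _; lra.
  apply: (le_trans (bn k (a k) z (ltW (a0 k)) ak1)).
  rewrite lecR /A -[leRHS]mulrA ler_wpM2l ?decay_ge0// -[leRHS]mulrA ler_wpM2l//.
  rewrite -expRD ler_expR mulNr lerD2r.
  have -> : a k * (k.1%:R + k.2%:R + 2) = 1.
    by rewrite mulVf// gt_eqF// ltr_wpDl// addr_ge0.
  have := a1 k; have := a0 k => x0 x1.
  by rewrite ler_pdivrMr; nra.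
have I1 k := integrable_gauss2 (a0 k) (mb k).1 (fun z => norm_Re_le (bA k z)).
have I2 k := integrable_gauss2 (a0 k) (mb k).2 (fun z => norm_Im_le (bA k z)).
have Asum : (\esum_(k in [set: N2]) (A k * (pi / a k))%:E < +oo)%E.
  have P0 : 0 <= 8 * expR 2 * pi :> R by rewrite !mulr_ge0 ?expR_ge0 ?pi_ge0.
  apply: le_lt_trans (decay_poly_sum 3 P0); apply: le_esum => k _; rewrite lee_fin.
  rewrite /A /a invrK.
  have -> : decay B r k.1 k.2 * (pol k * expR 2) * (pi * (k.1%:R + k.2%:R + 2)) =
    (expR 2 * pi) * ((pol k * (k.1%:R + k.2%:R + 2)) * decay B r k.1 k.2) by ring.
  have -> : 8 * expR 2 * pi * ((k.1 + k.2).+1%:R ^+ 3 * decay B r k.1 k.2) =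
    (expR 2 * pi) * ((4 * (k.1 + k.2).+1%:R ^+ 2) * (2 * (k.1 + k.2).+1%:R) *
      decay B r k.1 k.2) by ring.
  rewrite ler_wpM2l ?mulr_ge0 ?expR_ge0 ?pi_ge0// ler_wpM2r ?decay_ge0//.
  apply: ler_pM => //.
  rewrite -(natr1 (k.1 + k.2)) natrD; have := ler0n R k.1; have := ler0n R k.2; lra.
transitivity (cintegral mu2 (fun z => csum (b^~ z))).
  rewrite /fourier2; congr cintegral; apply/funext => z.
  have -> : csum (b^~ z) =
      e z * csum (fun k => (pi^-1)%:C * c k * cross k.1 k.2 z.1 z.2).
    exact: (csumZ (e z) (cs z)).
  congr (_ * csum _); apply/funext => k; rewrite wigner_coefE; ring.
rewrite cintegral_csum//; last 2 first.
- by apply: le_lt_trans Asum; apply: le_esum => k _; exact: (I1 k).2.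
- by apply: le_lt_trans Asum; apply: le_esum => k _; exact: (I2 k).2.
congr csum; apply/funext => k.
have -> : b k = (fun z => ((pi^-1)%:C * c k) * (e z * cross k.1 k.2 z.1 z.2)).
  by apply/funext => z; rewrite /b; ring.
pose C : R := (2 * k.1%:R + 2) * (2 * k.2%:R + 2) *
  expR (1 / 4 * (k.1%:R + k.2%:R + 2) / (1 - (1 / 4) ^+ 2)).
have q14 : 0 < 1 / 4 :> R by []. have q1 : 1 / 4 < 1 :> R by lra.
have FC z : `|e z * cross k.1 k.2 z.1 z.2| <=
    (C * expR (- (1 / 4) * (z.1 ^+ 2 + z.2 ^+ 2)))%:C.
  rewrite normrM norm_expi [leLHS]mul1r.
  apply: (le_trans (cross_bound k.1 k.2 z.1 z.2 (ltW q14) q1)).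
  by rewrite lecR /C -[leRHS]mulrA -expRD mulNr.
have [m1 m2] : cmeasurable (fun z => e z * cross k.1 k.2 z.1 z.2).
  by apply: cmeasurableM; [exact: cmeasurable_character|exact: cmeasurable_cross].
rewrite cintegralZ; last 2 first.
- exact: (integrable_gauss2 q14 m1 (fun z => norm_Re_le (FC z))).1.
- exact: (integrable_gauss2 q14 m2 (fun z => norm_Im_le (FC z))).1.
rewrite -/(fourier2 (cross k.1 k.2) u v) fourier2_cross rmorphM /=.
have pV : (pi^-1)%:C * (pi%:C) = 1 :> R[i].
  by rewrite -rmorphM /= mulVf// gt_eqF ?pi_gt0.
transitivity ((pi^-1)%:C * (pi%:C) *
  (c k * (((-1) ^+ k.1)%:C * cross k.1 k.2 (v / 2) (- u / 2)))).
  by ring.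
by rewrite pV; ring.
Qed.

Lemma norm_csum_wigner q p z M : q ^+ 2 + p ^+ 2 = z ^+ 2 ->
  (forall x : N2 -> R,
    (forall k (a : R), 0 <= a -> a < 1 -> x k <= decay B r k.1 k.2 * (pol k *
     expR (a * (k.1%:R + k.2%:R + 2) / (1 - a ^+ 2) - a * z ^+ 2))) ->
    (\esum_(k in [set: N2]) (x k)%:E <= M%:E)%E) ->
  `|csum (fun k : N2 => c k * wigner_coef k.1 k.2 q p)| <= (M + M)%:C.
Proof.
move=> qp H; have := @csum_cross_le (fun=> (pi^-1)%:C) q p z M (fun=> piV1) qp H.
congr (`|csum _| <= _); apply/funext => k; rewrite wigner_coefE; ring.
Qed.

End main.

Theorem proposition1 (R : realType) (r B beta : R) :
  0 < r -> r < 2 -> 0 < B -> beta < B ->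
  exists z0 : R, forall rho : (R -> R[i]) -> (R -> R[i]),
    quantum_state rho ->
    (forall m n : nat, (n <= m)%N ->
      `|density_matrix rho m n| <= (decay B r m n)%:C) ->
    forall q p : R,
      let z := Num.sqrt (q ^+ 2 + p ^+ 2) in
      z0 <= z ->
      `|wigner rho q p|
        <= (decay_amplitude r B z * expR (- beta * z `^ r))%:C /\
      `|wigner_fourier rho q p|
        <= (decay_amplitude r B (z / 2) * expR (- beta * (z / 2) `^ r))%:C.
Proof.
move=> r0 r2 B0 bB.
(* half of [1/pi] for the real part of the value, half for its imaginary part *)
have e0 : 0 < pi^-1 / 2 :> R by rewrite divr_gt0// invr_gt0 pi_gt0.
have [z0 z00 H] := weighted_sum_decay r0 r2 B0 bB e0.
(* the factor [2] serves the Fourier transform, which is evaluated at [z / 2] *)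
exists (2 * z0) => rho qs hrho q p z zz0.
have zge0 : 0 <= z by exact: sqrtr_ge0.
have z2 : q ^+ 2 + p ^+ 2 = z ^+ 2 by rewrite sqr_sqrtr// addr_ge0 ?sqr_ge0.
pose c (k : nat * nat) := density_matrix rho k.1 k.2.
have cD k : `|c k| <= (decay B r k.1 k.2)%:C.
  have DC m n : decay B r m n = decay B r n m by rewrite /decay addnC.
  exact: (density_matrix_norm qs DC hrho).
pose M y := pi^-1 / 2 * expR (- beta * y `^ r).
have amp y : 0 <= y ->
    ((M y + M y)%:C <= (decay_amplitude r B y * expR (- beta * y `^ r))%:C :> R[i]).
  move=> y0; rewrite lecR -mulrDl ler_wpM2r ?expR_ge0// -splitr.
  exact: decay_amplitude_ge.
have zh0 : 0 <= z / 2 by rewrite divr_ge0.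
split.
  apply: le_trans (amp z zge0); apply: (norm_csum_wigner cD z2); apply: H; lra.
rewrite /wigner_fourier /wigner (fourier2_csum r0 B0 cD).
apply: le_trans (amp _ zh0); apply: (csum_cross_le cD (z := z / 2)).
- by move=> k; rewrite rmorphXn /= normrX rmorphN normrN1 expr1n.
- by rewrite [RHS]exprMn -z2; field.
- by apply: H; lra.
Qed.
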